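(* Let $\Delta=\operatorname{conv}\{\alpha(0),\dots,\alpha(n)\}\subset\mathbb{R}^n$ be an $n$-dimensional even simplex, i.e. $\alpha(j)\in(2\mathbb{N})^n$ for all $0\le j\le n$, let $y\in\operatorname{int}(\Delta)\cap\mathbb{N}^n$, and let $f=\sum_{j=0}^n b_j\mathbf{x}^{\alpha(j)}+c\,\mathbf{x}^y\in P_\Delta^y$ (so $b_j>0$ and $c\in\mathbb{R}^*$). Let $\Theta_f$ be the circuit number of $f$. (A) The following are equivalent: (1) $c\in[-\Theta_f,\Theta_f]$ if $y\notin(2\mathbb{N})^n$, and $c\ge-\Theta_f$ if $y\in(2\mathbb{N})^n$; (2) $f$ is nonnegative, i.e. $f(\mathbf{x})\ge 0$ for all $\mathbf{x}\in\mathbb{R}^n$. (B) $f$ lies on the boundary of the set of nonnegative polynomials in $P_\Delta^y$ if and only if $|c|=\Theta_f$ in the case $y\notin(2\mathbb{N})^n$, respectively $c=-\Theta_f$ in the case $y\in(2\mathbb{N})^n$. In these cases, if $\alpha(0)=0$, $f$ has at most $2^n$ zeros in $\mathbb{R}^n$, and any two of these zeros differ only in the signs of their coordinates. (C) Assume furthermore that $n\ge2$ and that $f$ is not a sum of monomial squares with $c>0$. Then the following are equivalent: (1) $f$ is nonnegative, i.e. $c\in[-\Theta_f,\Theta_f]$ if $y\notin(2\mathbb{N})^n$ and $c\in[-\Theta_f,0]$ if $y\in(2\mathbb{N})^n$; (2) the amoeba $\mathcal{A}(f)$ is solid.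
   Context: $\mathbb{N}=\{0,1,2,\dots\}$, $\mathbb{R}^*=\mathbb{R}\setminus\{0\}$, $\mathbb{C}^*=\mathbb{C}\setminus\{0\}$, $\mathbf{x}=(x_1,\dots,x_n)$. For an $n$-dimensional lattice simplex $\Delta=\operatorname{conv}\{\alpha(0),\dots,\alpha(n)\}\subset\mathbb{R}^n$ with vertices $\alpha(j)$ and a lattice point $y\in\operatorname{int}(\Delta)$, $P_\Delta^y$ denotes the set of polynomials $f=\sum_{j=0}^n b_j\mathbf{x}^{\alpha(j)}+c\,\mathbf{x}^y\in\mathbb{R}[\mathbf{x}]$ with all $b_j\in\mathbb{R}_{>0}$ and $c\in\mathbb{R}^*$. It is identified with $\mathbb{R}_{>0}^{n+1}\times\mathbb{R}^*$ via coefficients, and ''boundary'' refers to the Euclidean topology on this set. The circuit number of $f$ is $\Theta_f=\prod_{j=0}^n\left(\frac{b_j}{\lambda_j}\right)^{\lambda_j}$, where the $\lambda_j$ are the unique numbers with $y=\sum_{j=0}^n\lambda_j\alpha(j)$, $\lambda_j\ge0$, $\sum_{j=0}^n\lambda_j=1$ (all $\lambda_j>0$ since $y$ is interior). A polynomial is a sum of monomial squares if every term $b_\alpha\mathbf{x}^\alpha$ occurring in it satisfies $b_\alpha>0$ and $\alpha\in(2\mathbb{N})^n$. The amoeba of $f$ is $\mathcal{A}(f)=\{(\log|z_1|,\dots,\log|z_n|):\mathbf{z}\in(\mathbb{C}^* )^n,\ f(\mathbf{z})=0\}\subset\mathbb{R}^n$. It is called solid if its complement $\mathbb{R}^n\setminus\mathcal{A}(f)$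 has no bounded connected components. *)

(* Defs.v *)
From mathcomp Require Import all_boot all_order all_algebra complex.
From mathcomp Require Import all_classical all_reals all_analysis.
From mathcomp Require Import -(notations) mpoly.

Set Implicit Arguments.
Unset Strict Implicit.
Unset Printing Implicit Defensive.

Import Order.TTheory GRing.Theory Num.Theory.
Import numFieldNormedType.Exports.

Local Open Scope classical_set_scope.
Local Open Scope ring_scope.

(* mpoly is imported without its notations, which clash with analysis.
   R^n is 'rV[R]_n; N^n is multinom n, the exponents of {mpoly R[n]}. *)

Definition even_mnm (n : nat) (m : multinom n) : bool :=
  [forall i, ~~ odd (m i)].

Definition mnm_point (R : realType) (n : nat) (m : multinom n) : 'rV[R]_n :=
  \row_i (m i)%:R.

Definition convex_coords (R : realType) (n k : nat) (v : 'I_k -> 'rV[R]_n)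
    (x : 'rV[R]_n) (lam : 'I_k -> R) : Prop :=
  [/\ forall j, 0 <= lam j, \sum_j lam j = 1 & x = \sum_j lam j *: v j].

Definition conv_hull (R : realType) (n k : nat) (v : 'I_k -> 'rV[R]_n) :
    set 'rV[R]_n :=
  [set x | exists lam, convex_coords v x lam].

Definition affinely_independent (R : realType) (n k : nat)
    (v : 'I_k -> 'rV[R]_n) : Prop :=
  forall mu : 'I_k -> R,
    \sum_j mu j = 0 -> \sum_j mu j *: v j = 0 -> forall j, mu j = 0.

Definition circuit_poly (R : realType) (n : nat)
    (alpha : 'I_n.+1 -> multinom n) (y : multinom n)
    (b : 'rV[R]_n.+1) (c : R) : mpoly n R :=
  \sum_j b 0 j *: mpolyX R (alpha j) + c *: mpolyX R y.

(* P_Delta^y, identified with R_{>0}^{n+1} x R^* via coefficients. *)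
Definition circuit_coefs (R : realType) (n : nat) : set ('rV[R]_n.+1 * R) :=
  [set p : 'rV[R]_n.+1 * R | (forall j, 0 < p.1 0 j) /\ p.2 != 0].

Definition circuit_number (R : realType) (n : nat)
    (lam : 'I_n.+1 -> R) (b : 'rV[R]_n.+1) : R :=
  \prod_j (b 0 j / lam j) `^ lam j.

Definition nonneg_poly (R : realType) (n : nat) (f : mpoly n R) : Prop :=
  forall x : 'rV[R]_n, 0 <= meval (x 0) f.

Definition real_zeros (R : realType) (n : nat) (f : mpoly n R) :
    set 'rV[R]_n :=
  [set x | meval (x 0) f = 0].

Definition sum_of_monomial_squares (R : realType) (n : nat) (f : mpoly n R) :
    Prop :=
  forall m, m \in msupp f -> 0 < mcoeff m f /\ even_mnm m.

Definition nonneg_coefs (R : realType) (n : nat)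
    (alpha : 'I_n.+1 -> multinom n) (y : multinom n) :
    set ('rV[R]_n.+1 * R) :=
  [set p : 'rV[R]_n.+1 * R | circuit_coefs p /\ nonneg_poly (circuit_poly alpha y p.1 p.2)].

(* The topological boundary of S relative to the subspace A; points outside
   A, which are isolated in the library's [subspace A], are excluded. *)
Definition boundary_in (T : topologicalType) (A S : set T) : set T :=
  A `&` (@closure (subspace A) S `&` @closure (subspace A) (A `\` S)).

Definition amoeba (R : realType) (n : nat) (f : mpoly n R) : set 'rV[R]_n :=
  [set w | exists z : 'I_n -> R[i],
    [/\ forall i, z i != 0,
        meval z (map_mpoly (real_complex R) f) = 0
      & w = \row_i ln (ComplexField.Normc.normc (z i))]].

Definition solid (R : realType) (n : nat) (A : set 'rV[R]_n) : Prop :=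
  forall w, (~` A) w -> ~ bounded_set (connected_component (~` A) w).

(* Main.v *)
Require Import Defs.
From mathcomp Require Import all_boot all_order all_algebra complex.
From mathcomp Require Import all_classical all_reals all_analysis.
From mathcomp Require Import -(notations) mpoly.
From mathcomp Require Import ring lra.

Set Implicit Arguments.
Unset Strict Implicit.
Unset Printing Implicit Defensive.

Import Order.TTheory GRing.Theory Num.Theory.
Import numFieldNormedType.Exports.

Local Open Scope classical_set_scope.
Local Open Scope ring_scope.

(** Put x = s exp(w) with signs s and let l_j be the barycentric coordinates of
    y. Since the alpha(j) are even,
      f(x) = exp<w,y> (g(w) +- c),   g(w) = sum_j b_j exp<w, alpha(j) - y>,
    the minus sign being available exactly when y has an odd entry. Choosing w*
    so that every term of g at w* is l_j Theta (the linear system is solvable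
    because the alpha(j) are affinely independent) and using 1 + u <= exp u
    termwise, g has minimum Theta, attained only at w*
    ([equilibrium], [gsum_min]). This gives (A), and it shows that an extremal f
    with constant term vanishes only at points with |x_i| = exp(w*_i). For the
    boundary statement, shrinking b by a factor k < 1 shrinks Theta by the same
    factor, so strict inequality for c is preserved near (b, c) without any
    analysis of Theta as a function of b ([nonneg_interior]).

    For (C), where c < 0 or y has an odd entry, signs can be chosen so that c x^y
    becomes - |c| x^y while the other terms stay positive. The points with absolute
    values exp w are the exp(w + i th), and w lies in the amoeba iff for some phi
    in R^(n+1) with sum_j l_j phi_j = 0
      sum_j r_j exp(i phi_j) = |c| exp<w,y>,   r_j = b_j exp<w,alpha(j)>.

    If |c| > Theta, the point w* is outside the amoeba because the inner term
    exceeds all the others together, while every w with g(w) = |c| is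
    in it; hence the component of w* stays in the bounded set g < |c|
    ([not_nonneg_not_solid]).

    If |c| <= Theta, the bar of length |c| exp<w,y> is at most the sum of the arms
    r_j. Either the linkage of these arms can be closed under the constraint on
    the angles, so w is in the amoeba, or some arm r_j exceeds the bar plus the
    length of the resultant of the other arms in a suitable position
    ([arms_dichotomy]; here n >= 2 is used, since one needs three arms). In the
    second case let m be an integral direction along which <m, alpha(k)> is
    constant for k <> j and larger for k = j. On the torus over w, restricting f
    to u |-> u^m gives, up to a monomial, polynomials of fixed degree in u that
    depend continuously on the point of the torus. None of them has a root on the
    unit circle, since w is outside the amoeba, and one of them has no root
    outside the disc, since arm j dominates. By continuity of roots none of them
    has one ([no_root_crossing]), so the whole ray w + s m, s >= 0, avoids the
    amoeba and the component of w is unbounded ([ray_complement],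
    [nonneg_solid]). *)

(** * Planar linkages with a constraint on the angles *)

Section Linkages.
Variable R : realType.
Implicit Types (x y a b d t g : R).

(** The arc cosine precomposed with this truncation is continuous on the whole
    line, so that angle functions of a linkage need no domain condition. *)
Definition clamp1 (x : R) : R := Num.max (- 1) (Num.min 1 x).

Lemma clamp1_itv x : - 1 <= clamp1 x <= 1.
Proof. by rewrite /clamp1 le_max lexx /= ge_max ge_min lexx /= andbT; lra. Qed.

Lemma clamp1_id x : - 1 <= x <= 1 -> clamp1 x = x.
Proof. by move=> /andP[x1 x2]; rewrite /clamp1 min_r// max_r. Qed.

(** A decreasing surjection between intervals is continuous; this includes the
    end points of [-1, 1], where acos has no derivative. *)
Lemma acos_clamp_continuous : continuous (fun x : R => acos (clamp1 x)).
Proof.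
have clampc : continuous clamp1.
  have -> : clamp1 = (fun=> - 1) \max ((fun=> 1) \min id) by [].
  apply: max_fun_continuous; first exact: cst_continuous.
  by apply: min_fun_continuous; [exact: cst_continuous|move=> ?; exact: cvg_id].
have acosc : {within `[(-1 : R), 1], continuous (@acos R)}.
  apply: segment_dec_surj_continuous.
    have acosI z : z \in `[-1, 1] -> acos z \in `[0, (pi : R)].
      by rewrite !in_itv/= => zI; rewrite acos_ge0// acos_lepi.
    by move=> x y xI yI; rewrite !leNgt -ltr_cos ?acosI// !acosK.
  rewrite acos1 acosN1 => z /= zI; exists (cos z); last exact: cosK.
  by rewrite /= in_itv/= cos_geN1 cos_le1.
move=> x; apply: (@cvg_comp _ _ _ clamp1 acos _ (within `[(-1), 1] (nbhs (clamp1 x)))).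
  move=> B; rewrite /within/= => nB.
  have h : \forall y \near x, clamp1 y \in `[(-1), 1] -> B (clamp1 y).
    exact: clampc x _ nB.
  by apply: filterS h => y; apply; rewrite in_itv/= clamp1_itv.
by move/subspace_continuousP : acosc; apply; rewrite /= in_itv/= clamp1_itv.
Qed.

(** Law of cosines: the angles that the sides a and b make with the side D of a
    triangle. *)
Lemma triangle_angles a b D : 0 < a -> 0 < b -> 0 < D ->
  `|a - b| <= D -> D <= a + b ->
  let p := acos (clamp1 ((a ^+ 2 + D ^+ 2 - b ^+ 2) / (2 * a * D))) in
  let q := acos (clamp1 ((b ^+ 2 + D ^+ 2 - a ^+ 2) / (2 * b * D))) in
  a * cos p + b * cos q = D /\ a * sin p = b * sin q.
Proof.
move=> a0 b0 D0; rewrite ler_norml => /andP[h1 h2] h3.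
have itv u v : 0 < u -> 0 < v -> v - u <= D -> u - v <= D -> D <= u + v ->
    - 1 <= (u ^+ 2 + D ^+ 2 - v ^+ 2) / (2 * u * D) <= 1.
  move=> u0 v0 k1 k2 k3.
  have uD : 0 < 2 * u * D by rewrite !mulr_gt0.
  rewrite ler_pdivlMr// ler_pdivrMr// mulN1r mul1r; apply/andP; split.
    rewrite -subr_ge0 opprK.
    have -> : u ^+ 2 + D ^+ 2 - v ^+ 2 + 2 * u * D = (u + D - v) * (u + D + v) by ring.
    by rewrite mulr_ge0//; lra.
  rewrite -subr_ge0.
  have -> : 2 * u * D - (u ^+ 2 + D ^+ 2 - v ^+ 2) = (v - (u - D)) * (v + u - D) by ring.
  by rewrite mulr_ge0//; lra.
have pI : - 1 <= (a ^+ 2 + D ^+ 2 - b ^+ 2) / (2 * a * D) <= 1 by apply: itv => //; lra.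
have qI : - 1 <= (b ^+ 2 + D ^+ 2 - a ^+ 2) / (2 * b * D) <= 1 by apply: itv => //; lra.
rewrite /= !clamp1_id// !acosK ?in_itv//; split.
  by field; rewrite !gt_eqF.
have sE u X : 0 < u -> - 1 <= X <= 1 -> u * sin (acos X) = Num.sqrt (u ^+ 2 * (1 - X ^+ 2)).
  move=> u0 XI; rewrite sqrtrM ?sqr_ge0// sqrtr_sqr gtr0_norm// sin_acos//.
rewrite !sE//; congr Num.sqrt; field.
by rewrite !gt_eqF.
Qed.

(** The bar from 0 to g is bridged by three arms: one of length d, held at angle
    t, and two of lengths a and b, which with the remaining gap of length
    |g - d exp(i t)| form a triangle. Since d < g the gap never vanishes and its
    direction is a continuous function of t (an arc tangent), so the two angles
    p and q can be chosen continuous. When the gap has length a + b the triangle is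
    flat and the configuration at - t is the mirror image of the one at t. *)
Lemma crank g d a b : 0 <= d -> d < g -> 0 < a -> 0 < b -> `|a - b| <= g - d ->
  exists p q : R -> R,
  [/\ continuous p /\ continuous q,
      forall t, `|p t| <= 2 * pi /\ `|q t| <= 2 * pi,
      forall t, g ^+ 2 + d ^+ 2 - 2 * g * d * cos t <= (a + b) ^+ 2 ->
        a * cos (p t) + b * cos (q t) + d * cos t = g /\
        a * sin (p t) + b * sin (q t) + d * sin t = 0
    & forall t, g ^+ 2 + d ^+ 2 - 2 * g * d * cos t = (a + b) ^+ 2 ->
        p (- t) = - p t /\ q (- t) = - q t].
Proof.
move=> d0 dg a0 b0 abgd.
have g0 : 0 < g by lra.
have pi0 : 0 < pi :> R := pi_gt0 R.
pose Q t := g ^+ 2 + d ^+ 2 - 2 * g * d * cos t.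
pose D t := Num.sqrt (Q t).
pose x t := g - d * cos t.
pose om t := atan (- d * sin t / x t).
pose A t := acos (clamp1 ((a ^+ 2 + D t ^+ 2 - b ^+ 2) / (2 * a * D t))).
pose B t := acos (clamp1 ((b ^+ 2 + D t ^+ 2 - a ^+ 2) / (2 * b * D t))).
have x0 t : 0 < x t.
  rewrite subr_gt0; apply: le_lt_trans dg.
  by rewrite ler_piMr// cos_le1.
have QE t : Q t = x t ^+ 2 + (d * sin t) ^+ 2.
  rewrite /Q /x; have := cos2Dsin2 t; set c := cos t; set s := sin t => cs.
  have -> : (d * s) ^+ 2 = d ^+ 2 * (1 - c ^+ 2) by rewrite exprMn -cs; ring.
  ring.
have Qgd t : (g - d) ^+ 2 <= Q t.
  have -> : Q t = (g - d) ^+ 2 + 2 * g * d * (1 - cos t) by rewrite /Q; ring.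
  by rewrite lerDl mulr_ge0// ?subr_ge0 ?cos_le1// mulr_ge0//; lra.
have Q0 t : 0 < Q t by apply: lt_le_trans (Qgd t); rewrite exprn_gt0// subr_gt0.
have D0 t : 0 < D t by rewrite sqrtr_gt0.
have D2 t : D t ^+ 2 = Q t by rewrite sqr_sqrtr// ltW.
have Dgd t : `|a - b| <= D t.
  apply: le_trans abgd _; rewrite -(ler_pXn2r (ltn0Sn 1)) ?nnegrE ?D2//; last exact: ltW.
  by rewrite subr_ge0 ltW.
have xc : continuous x.
  move=> t; apply: cvgB; first exact: cvg_cst.
  by apply: cvgM; [exact: cvg_cst|exact: continuous_cos].
have Dc : continuous D.
  move=> t; apply: (@cvg_comp _ _ _ Q Num.sqrt); last exact: sqrt_continuous.
  apply: cvgB; first exact: cvg_cst.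
  by apply: cvgM; [exact: cvg_cst|exact: continuous_cos].
have omc : continuous om.
  move=> t; apply: (@cvg_comp _ _ _ (fun t => - d * sin t / x t) atan); last exact: continuous_atan.
  apply: cvgM; first by apply: cvgM; [exact: cvg_cst|exact: continuous_sin].
  by apply: cvgV; [rewrite gt_eqF|exact: xc].
have Ac u v : 0 < u ->
    continuous (fun t => acos (clamp1 ((u ^+ 2 + D t ^+ 2 - v ^+ 2) / (2 * u * D t)))).
  move=> u0 t.
  apply: (@cvg_comp _ _ _ (fun t => (u ^+ 2 + D t ^+ 2 - v ^+ 2) / (2 * u * D t))
    (fun x => acos (clamp1 x))); last exact: acos_clamp_continuous.
  apply: cvgM.
    apply: cvgB; last exact: cvg_cst.
    apply: cvgD; first exact: cvg_cst.
    by apply: cvgM; exact: Dc.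
  apply: cvgV; first by rewrite gt_eqF// !mulr_gt0.
  by apply: cvgM; [exact: cvg_cst|exact: Dc].
exists (fun t => om t + A t), (fun t => om t - B t); split.
- by split=> t; [apply: cvgD|apply: cvgB]; (exact: omc || exact: Ac).
- move=> t.
  have /andP[h1 h2] : - (pi / 2) < om t < pi / 2 by rewrite atan_gtNpi2 atan_ltpi2.
  have h3 := acos_ge0 (clamp1_itv ((a ^+ 2 + D t ^+ 2 - b ^+ 2) / (2 * a * D t))).
  have h4 := acos_lepi (clamp1_itv ((a ^+ 2 + D t ^+ 2 - b ^+ 2) / (2 * a * D t))).
  have h5 := acos_ge0 (clamp1_itv ((b ^+ 2 + D t ^+ 2 - a ^+ 2) / (2 * b * D t))).
  have h6 := acos_lepi (clamp1_itv ((b ^+ 2 + D t ^+ 2 - a ^+ 2) / (2 * b * D t))).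
  by rewrite /A /B !ler_norml; split; apply/andP; split; lra.
- move=> t Dab.
  have {}Dab : D t <= a + b.
    by rewrite -(ler_pXn2r (ltn0Sn 1)) ?nnegrE ?D2//; [exact: ltW|lra].
  have [] := triangle_angles a0 b0 (D0 t) (Dgd t) Dab.
  rewrite -/(A t) -/(B t) => h1 h2.
  have co : cos (om t) = x t / D t.
    rewrite cos_atan; apply: (canRL (mulfK _)); first by rewrite gt_eqF.
    have -> : 1 + (- d * sin t / x t) ^+ 2 = Q t * (x t)^-1 ^+ 2.
      by rewrite QE; field; rewrite gt_eqF.
    rewrite sqrtrM ?ltW// sqrtr_sqr gtr0_norm ?invr_gt0// -/(D t).
    by field; rewrite !gt_eqF.
  have so : sin (om t) = - d * sin t / D t.
    have := atanK (- d * sin t / x t); rewrite -/(om t) /tan co => /(canRL (mulfK _)) ->.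
      by field; rewrite !gt_eqF.
    by rewrite gt_eqF ?invr_gt0 ?divr_gt0.
  rewrite cosD cosB sinD sinB; split.
    have -> : a * (cos (om t) * cos (A t) - sin (om t) * sin (A t)) +
      b * (cos (om t) * cos (B t) + sin (om t) * sin (B t)) + d * cos t =
      cos (om t) * (a * cos (A t) + b * cos (B t))
      - sin (om t) * (a * sin (A t) - b * sin (B t)) + d * cos t by ring.
    rewrite h1 h2 subrr mulr0 subr0 co divfK ?gt_eqF// /x; ring.
  have -> : a * (sin (om t) * cos (A t) + cos (om t) * sin (A t)) +
    b * (sin (om t) * cos (B t) - cos (om t) * sin (B t)) + d * sin t =
    sin (om t) * (a * cos (A t) + b * cos (B t))
      + cos (om t) * (a * sin (A t) - b * sin (B t)) + d * sin t by ring.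
  by rewrite h1 h2 subrr mulr0 addr0 so divfK ?gt_eqF//; ring.
- move=> t Dab.
  have DN : D (- t) = D t by rewrite /D /Q cosN.
  have omN : om (- t) = - om t by rewrite /om /x sinN cosN -atanN; congr atan; ring.
  have {}Dab : D t = a + b.
    by rewrite /D /Q Dab sqrtr_sqr gtr0_norm// addr_gt0.
  have AE u v : 0 < u -> 0 < v ->
      acos (clamp1 ((u ^+ 2 + (u + v) ^+ 2 - v ^+ 2) / (2 * u * (u + v)))) = 0.
    move=> u0 v0; have -> : (u ^+ 2 + (u + v) ^+ 2 - v ^+ 2) / (2 * u * (u + v)) = 1.
      by field; rewrite !gt_eqF// addr_gt0.
    by rewrite clamp1_id ?acos1//; lra.
  rewrite /A /B omN DN Dab AE// (addrC a) AE// !addr0 !subr0.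
  by [].
Qed.

(** If the crank d can turn all the way round, t is unbounded while the other two
    angles stay bounded, so the weighted sum of angles takes every value. *)
Lemma cranked_arms g d a b (k0 k1 k2 s : R) :
    0 <= d -> d < g -> 0 < a -> 0 < b -> `|a - b| <= g - d -> g + d <= a + b ->
    0 < k2 ->
  exists p q t, [/\ k0 * p + k1 * q + k2 * t = s,
    a * cos p + b * cos q + d * cos t = g &
    a * sin p + b * sin q + d * sin t = 0].
Proof.
move=> d0 dg a0 b0 abgd gdab k20.
have [p [q [[pc qc] bnd closed _]]] := crank d0 dg a0 b0 abgd.
have g0 : 0 < g by lra.
pose S t := k0 * p t + k1 * q t + k2 * t.
have Sc : continuous S.
  move=> t; apply: cvgD; first by apply: cvgD; apply: cvgM;
    [exact: cvg_cst|exact: pc|exact: cvg_cst|exact: qc].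
  by apply: cvgM; [exact: cvg_cst|exact: cvg_id].
pose K := `|k0| * (2 * pi) + `|k1| * (2 * pi).
have pi0 : 0 < pi :> R := pi_gt0 R.
have K0 : 0 <= K by apply: addr_ge0; apply: mulr_ge0 => //; apply: mulr_ge0 => //; exact: ltW.
have Kb t : `|k0 * p t + k1 * q t| <= K.
  have [h1 h2] := bnd t.
  by rewrite (le_trans (ler_normD _ _))// !normrM lerD// ler_wpM2l.
(* k2 T outweighs the bounded part of the sum by |s| *)
pose T := (`|s| + K) / k2.
have T0 : 0 <= T by apply: divr_ge0; [apply: addr_ge0|exact: ltW].
have kT : k2 * T = `|s| + K by rewrite mulrC divfK ?gt_eqF.
have NT : - T <= T by lra.
have := ler_norm s; have := ler_norm (- s); rewrite normrN => sN sP.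
have [| t _ St] := IVT (v := s) NT (continuous_subspaceT Sc).
  have := Kb T; have := Kb (- T); rewrite !ler_norml => /andP[h1 h2] /andP[h3 h4].
  rewrite ge_min le_max /S mulrN kT; apply/andP; split; apply/orP; [left|right]; lra.
suff /closed[h1 h2] : g ^+ 2 + d ^+ 2 - 2 * g * d * cos t <= (a + b) ^+ 2.
  by exists (p t), (q t), t.
have -> : (a + b) ^+ 2 = (g + d) ^+ 2 + (a + b - (g + d)) * (a + b + (g + d)) by ring.
have -> : g ^+ 2 + d ^+ 2 - 2 * g * d * cos t = (g + d) ^+ 2 - 2 * g * d * (1 + cos t) by ring.
apply: (@le_trans _ _ ((g + d) ^+ 2)).
  have : 0 <= 2 * g * d * (1 + cos t).
    by rewrite !mulr_ge0 ?(ltW g0)//; have := cos_geN1 t; lra.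
  lra.
by rewrite lerDl mulr_ge0//; lra.
Qed.

(** When the crank cannot turn all the way, its extreme positions t = - tau and
    t = tau are flat and mirror images of each other, so the weighted sum of
    angles changes sign in between. *)
Lemma three_arms g d a b (k0 k1 k2 : R) :
    0 < d -> d <= g -> 0 < a -> 0 < b -> `|a - b| <= g - d -> g - d <= a + b ->
    0 < k0 -> 0 < k1 -> 0 < k2 ->
  exists p q t, [/\ k0 * p + k1 * q + k2 * t = 0,
    a * cos p + b * cos q + d * cos t = g &
    a * sin p + b * sin q + d * sin t = 0].
Proof.
move=> d0 dg a0 b0 abgd gdab k00 k10 k20.
have [dEg|dNg] := eqVneq d g.
  (* the gap g - d exp(i t) vanishes at t = 0: point the arms a = b in opposite directions *)
  have aEb : a = b by move: abgd; rewrite dEg subrr normr_le0 subr_eq0 => /eqP.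
  exists (- k1 * pi / (k0 + k1)), (- k1 * pi / (k0 + k1) + pi), 0.
  rewrite cosDpi sinDpi cos0 sin0 -dEg aEb; split; [|ring|ring].
  by field; rewrite gt_eqF// addr_gt0.
have {}dg : d < g by rewrite lt_neqAle dNg.
have [gdab2|abgd2] := leP (g + d) (a + b).
  by apply: cranked_arms => //; exact: ltW.
have [p [q [[pc qc] _ closed ends]]] := crank (ltW d0) dg a0 b0 abgd.
have g0 : 0 < g by lra.
have gd0 : 0 < 2 * g * d by rewrite !mulr_gt0.
pose X := (g ^+ 2 + d ^+ 2 - (a + b) ^+ 2) / (2 * g * d).
have XI : - 1 <= X <= 1.
  rewrite ler_pdivlMr// ler_pdivrMr//; apply/andP; split; rewrite -subr_ge0.
    have -> : g ^+ 2 + d ^+ 2 - (a + b) ^+ 2 - -1 * (2 * g * d) =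
       (g + d - (a + b)) * (g + d + (a + b)) by ring.
    by rewrite mulr_ge0//; lra.
  have -> : 1 * (2 * g * d) - (g ^+ 2 + d ^+ 2 - (a + b) ^+ 2) =
       (a + b - (g - d)) * (a + b + (g - d)) by ring.
  by rewrite mulr_ge0//; lra.
(* at angle tau the gap has length a + b *)
pose tau := acos X.
have tau0 : 0 <= tau by exact: acos_ge0.
have ctau : cos tau = X by rewrite acosK.
have XE : g ^+ 2 + d ^+ 2 - 2 * g * d * cos tau = (a + b) ^+ 2.
  by rewrite ctau mulrC divfK ?gt_eqF//; ring.
pose S t := k0 * p t + k1 * q t + k2 * t.
have Sc : continuous S.
  move=> t; apply: cvgD; first by apply: cvgD; apply: cvgM;
    [exact: cvg_cst|exact: pc|exact: cvg_cst|exact: qc].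
  by apply: cvgM; [exact: cvg_cst|exact: cvg_id].
have SN : S (- tau) = - S tau.
  by have [h1 h2] := ends _ XE; rewrite /S h1 h2; ring.
have NT : - tau <= tau by lra.
have [| t /[!in_itv]/= /andP[t1 t2] St] := IVT (v := 0) NT (continuous_subspaceT Sc).
  rewrite SN ge_min le_max oppr_le0 oppr_ge0.
  by have /orP[->//|->] := le_total 0 (S tau); rewrite orbT.
suff /closed[h1 h2] : g ^+ 2 + d ^+ 2 - 2 * g * d * cos t <= (a + b) ^+ 2.
  by exists (p t), (q t), t.
rewrite -XE lerD2l lerN2 ler_pM2l//.
have : `|t| <= tau by rewrite ler_norml t1.
have -> : cos t = cos `|t|.
  by case: (ger0P t) => // _; rewrite cosN.
move=> tt; have tauI : tau \in `[0, pi] by rewrite in_itv/= tau0 acos_lepi.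
have tI : `|t| \in `[0, (pi : R)] by rewrite in_itv/= normr_ge0 (le_trans tt)// acos_lepi.
by rewrite leNgt ltr_cos// -leNgt.
Qed.

Lemma rotate_arms (I : finType) (E : {set I}) (r psi : I -> R) d t :
    \sum_(i in E) r i * cos (psi i) = d ->
    \sum_(i in E) r i * sin (psi i) = 0 ->
  \sum_(i in E) r i * cos (t + psi i) = d * cos t /\
  \sum_(i in E) r i * sin (t + psi i) = d * sin t.
Proof.
move=> hc hs; split.
  under eq_bigr do rewrite cosD mulrBr mulrCA [X in _ - X]mulrCA.
  by rewrite sumrB -!mulr_sumr hc hs mulr0 subr0 mulrC.
under eq_bigr do rewrite sinD mulrDr mulrCA [X in _ + X]mulrCA.
by rewrite big_split/= -!mulr_sumr hc hs mulr0 addr0 mulrC.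
Qed.

Lemma two_arms a b d : 0 < a -> 0 < b -> 0 <= d -> `|a - b| <= d -> d <= a + b ->
  exists p q, a * cos p + b * cos q = d /\ a * sin p + b * sin q = 0.
Proof.
move=> a0 b0; rewrite le_eqVlt => /predU1P[<-|d0] abd dab.
  exists 0, pi; rewrite cos0 sin0 cospi sinpi.
  by move: abd; rewrite normr_le0 subr_eq0 => /eqP ->; split; ring.
have [h1 h2] := triangle_angles a0 b0 d0 abd dab.
set p := acos _ in h1 h2; set q := acos _ in h1 h2.
by exists p, (- q); rewrite cosN sinN h1 h2 mulrN subrr.
Qed.

(** Side lengths satisfying the polygon inequalities can be realised: take one
    side off, and close a triangle with the largest resultant d' of the remaining
    sides that the triangle inequality allows. *)
Lemma polygon (I : finType) (r : I -> R) (D : {set I}) d :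
    (forall i, 0 < r i) -> D != finset.set0 -> 0 <= d -> d <= \sum_(i in D) r i ->
    (forall j, j \in D -> r j <= d + \sum_(i in D :\ j) r i) ->
  exists psi : I -> R, \sum_(i in D) r i * cos (psi i) = d /\
                       \sum_(i in D) r i * sin (psi i) = 0.
Proof.
move=> r0; have [m] := ubnP #|D|; elim: m D d => // m IH D d /ltnSE Dm.
move=> /set0Pn[j jD] d0 dD rD.
have [E0|E0] := eqVneq (D :\ j) finset.set0.
  have rj : r j = d.
    apply/eqP; rewrite eq_le; move: (rD j jD) dD.
    by rewrite (big_setD1 j jD) /= E0 !big_set0 !addr0 => -> ->.
  exists (fun=> 0); rewrite !(big_setD1 j jD) /= E0 !big_set0 cos0 sin0; split; lra.
set E := D :\ j in E0 *.
pose d' := Num.min (\sum_(i in E) r i) (r j + d).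
have SE0 : 0 < \sum_(i in E) r i.
  have /set0Pn[k kE] := E0; rewrite (big_setD1 k)//=.
  by rewrite ltr_pwDl// sumr_ge0// => i _; exact: ltW.
have := rD j jD; rewrite -/E => rjE.
move: dD; rewrite (big_setD1 j jD) /= -/E => dD.
have rj0 := r0 j.
have d'0 : 0 < d' by rewrite lt_min SE0/=; lra.
have [d'1 d'2 d'3] : [/\ d' <= \sum_(i in E) r i, d' <= r j + d & `|r j - d'| <= d].
  rewrite ler_norml /d'; case: (lerP (\sum_(i in E) r i)) => ?; split=> //; try lra;
  apply/andP; split; lra.
have d'4 : d <= r j + d' by rewrite /d'; case: (lerP (\sum_(i in E) r i)) => ?; lra.
have [|k kE|psi [pc ps]] := IH E d' _ E0 (ltW d'0) d'1.
- by apply: leq_trans Dm; rewrite [X in (_ < X)%N](cardsD1 j) jD.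
- rewrite /d'; case: (lerP (\sum_(i in E) r i)) => ?.
    by rewrite [X in _ <= X + _](big_setD1 k)//= -addrA lerDl addr_ge0 ?sumr_ge0//
      => i _; exact: ltW.
  have kD : k \in D by move: kE; rewrite !inE => /andP[].
  have := rD k kD; rewrite (big_setD1 j)/=.
    by rewrite finset.setDDl finset.setUC -finset.setDDl -/E; lra.
  by move: kE; rewrite !inE jD eq_sym => /andP[->].
have [p [q [h1 h2]]] := two_arms rj0 d'0 d0 d'3 d'4.
have [e1 e2] := rotate_arms q pc ps.
have jE : forall i, i \in E -> (i == j) = false by move=> i; rewrite !inE => /andP[/negbTE].
exists (fun i => if i == j then p else q + psi i).
rewrite !(big_setD1 j jD) /= -/E eqxx; split.
  by rewrite (eq_bigr (fun i => r i * cos (q + psi i))) => [|i /jE ->//]; rewrite e1 h1.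
by rewrite (eq_bigr (fun i => r i * sin (q + psi i))) => [|i /jE ->//]; rewrite e2 h2.
Qed.

(** In the application l is the vector of barycentric coordinates, and the
    constraint characterises the angles that come from a point of the torus. *)
Definition closable (I : finType) (r l : I -> R) (D : {set I}) (g : R) :=
  exists phi : I -> R, [/\ \sum_(i in D) l i * phi i = 0,
    \sum_(i in D) r i * cos (phi i) = g &
    \sum_(i in D) r i * sin (phi i) = 0].

Lemma max_in (I : finType) (r : I -> R) (D : {set I}) : D != finset.set0 ->
  exists2 i, i \in D & forall j, j \in D -> r j <= r i.
Proof.
by move=> /set0Pn[j jD]; case: (arg_maxP r jD) => i iD h; exists i.
Qed.

Section Closable.
Variables (I : finType) (r l : I -> R).
Hypotheses (r0 : forall i, 0 < r i) (l0 : forall i, 0 < l i).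

(** The arms other than i0 and i1 are frozen in the shape psi and turned rigidly
    by t; they act as a single arm of length d and weight the sum of theirs. *)
Lemma glue_arms (D : {set I}) i0 i1 (psi : I -> R) p q t g d :
  let E := D :\ i0 :\ i1 in
  i0 \in D -> i1 \in D :\ i0 ->
  \sum_(i in E) r i * cos (psi i) = d ->
  \sum_(i in E) r i * sin (psi i) = 0 ->
  l i0 * p + l i1 * q + (\sum_(i in E) l i) * t = - \sum_(i in E) l i * psi i ->
  r i0 * cos p + r i1 * cos q + d * cos t = g ->
  r i0 * sin p + r i1 * sin q + d * sin t = 0 ->
  closable r l D g.
Proof.
move=> E i0D i1D pc ps hl hc hs.
have [e1 e2] := rotate_arms t pc ps.
exists (fun i => if i == i0 then p else if i == i1 then q else t + psi i).
have Ei : forall i, i \in E -> (i == i0) = false /\ (i == i1) = false.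
  by move=> i; rewrite !inE => /and3P[/negbTE-> /negbTE->].
have i10 : (i1 == i0) = false by move: i1D; rewrite !inE => /andP[/negbTE].
rewrite !(big_setD1 i0 i0D) !(big_setD1 i1 i1D) /= !eqxx i10 -/E; split.
- rewrite (eq_bigr (fun i => l i * t + l i * psi i)).
    by rewrite big_split/= -mulr_suml; move: hl; set u := \sum_(i in E) _ * _; lra.
  by move=> i /Ei[-> ->]; rewrite mulrDr.
- rewrite (eq_bigr (fun i => r i * cos (t + psi i))); last by move=> i /Ei[-> ->].
  by rewrite e1 addrA.
- rewrite (eq_bigr (fun i => r i * sin (t + psi i))); last by move=> i /Ei[-> ->].
  by rewrite e2 addrA.
Qed.

Lemma sum_arms_gt0 (k : I -> R) (E : {set I}) :
  (forall i, 0 < k i) -> E != finset.set0 -> 0 < \sum_(i in E) k i.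
Proof.
move=> k0 /set0Pn[j jE]; rewrite (big_setD1 j)//=.
by rewrite ltr_pwDl// sumr_ge0// => i _; exact: ltW.
Qed.

(** All the arms but two are laid in one straight line, which is [three_arms]. *)
Lemma aligned_closable (D : {set I}) i0 i1 g :
  let E := D :\ i0 :\ i1 in
  i0 \in D -> i1 \in D :\ i0 -> E != finset.set0 -> r i1 <= r i0 ->
  \sum_(i in E) r i <= g - r i0 + r i1 -> g <= \sum_(i in D) r i ->
  closable r l D g.
Proof.
move=> E i0D i1D E0 r10 h1; rewrite (big_setD1 i0 i0D) (big_setD1 i1 i1D) /= -/E => h2.
have re := sum_arms_gt0 r0 E0; have le := sum_arms_gt0 l0 E0.
have a0 := r0 i0; have a1 := r0 i1.
have [|||p [q [t [hl hc hs]]]] :=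
  three_arms re _ a0 a1 _ _ (l0 i0) (l0 i1) le (g := g).
- by lra.
- by rewrite ger0_norm; lra.
- by lra.
apply: (@glue_arms D i0 i1 (fun=> 0) p q t g (\sum_(i in E) r i)) => //.
- by apply: eq_bigr => i _; rewrite cos0 mulr1.
- by apply: big1 => i _; rewrite sin0 mulr0.
- by rewrite [X in - X]big1 ?oppr0// => i _; rewrite mulr0.
Qed.

(** A frozen shape psi shifts the weighted sum of angles by a constant, which is
    harmless when the shape can turn all the way round. *)
Lemma crank_closable (D : {set I}) i0 i1 (psi : I -> R) g d :
  let E := D :\ i0 :\ i1 in
  i0 \in D -> i1 \in D :\ i0 -> E != finset.set0 ->
  \sum_(i in E) r i * cos (psi i) = d ->
  \sum_(i in E) r i * sin (psi i) = 0 ->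
  0 <= d -> d < g -> `|r i0 - r i1| <= g - d -> g + d <= r i0 + r i1 ->
  closable r l D g.
Proof.
move=> E i0D i1D E0 pc ps d0 dg h1 h2.
have [p [q [t [hl hc hs]]]] := cranked_arms (l i0) (l i1)
  (- \sum_(i in E) l i * psi i) d0 dg (r0 i0) (r0 i1) h1 h2 (sum_arms_gt0 l0 E0).
exact: (glue_arms i0D i1D pc ps hl hc hs).
Qed.

(** Induction on the number of arms, with r0 >= r1 >= r2 the longest ones. Either
    aligning all but two works, or r0 can be laid along the bar and removed, or
    r0 + r1 > g and the remaining arms, folded up as short as possible, can turn
    all the way round. *)
Lemma dominated_closable (D : {set I}) g : (2 < #|D|)%N ->
  (forall j, j \in D -> r j <= g) -> g <= \sum_(i in D) r i -> closable r l D g.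
Proof.
have [m] := ubnP #|D|; elim: m D g => // m IH D g /ltnSE Dm D3 rg gD.
have D0 : D != finset.set0 by rewrite -card_gt0; apply: leq_trans D3.
have [i0 i0D i0max] := max_in r D0.
have cD1 : #|D| = #|D :\ i0|.+1 by rewrite (cardsD1 i0) i0D.
have D10 : D :\ i0 != finset.set0 by rewrite -card_gt0; move: D3; rewrite cD1; case: #|_|.
have [i1 i1D i1max] := max_in r D10.
have cD2 : #|D :\ i0| = #|D :\ i0 :\ i1|.+1 by rewrite (cardsD1 i1) i1D.
set E := D :\ i0 :\ i1 in cD2.
have E0 : E != finset.set0 by rewrite -card_gt0; move: D3; rewrite cD1 cD2; case: #|_|.
have r10 : r i1 <= r i0 by apply: i0max; move: i1D; rewrite inE => /andP[].
have [h|h] := leP (\sum_(i in E) r i) (g - r i0 + r i1).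
  exact: aligned_closable i0D i1D E0 r10 h gD.
have ri0g := rg i0 i0D; have ri0 := r0 i0; have ri1 := r0 i1.
have [i2 i2E i2max] := max_in r E0.
have r21 : r i2 <= r i1 by apply: i1max; move: i2E; rewrite inE => /andP[].
move: h; rewrite (big_setD1 i2 i2E) /=; set F := E :\ i2 => h.
have [hsum|hsum] := leP (r i0 + r i1) g.
  have F0 : F != finset.set0.
    by apply: contraTneq h => ->; rewrite big_set0 -leNgt; lra.
  have cE : #|E| = #|F|.+1 by rewrite (cardsD1 i2) i2E.
  have [||||phi [hl hc hs]] := IH (D :\ i0) (g - r i0).
  - by rewrite -cD1.
  - by rewrite cD2 cE !ltnS card_gt0.
  - by move=> j /i1max; lra.
  - by move: gD; rewrite (big_setD1 i0 i0D) /=; lra.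
  have ne i : i \in D :\ i0 -> (i == i0) = false by rewrite !inE => /andP[/negbTE].
  exists (fun i => if i == i0 then 0 else phi i).
  rewrite !(big_setD1 i0 i0D) /= eqxx cos0 sin0 mulr0 mulr0 mulr1 !add0r; split.
  - by rewrite -[RHS]hl; apply: eq_bigr => i /ne ->.
  - rewrite (eq_bigr (fun i => r i * cos (phi i))) => [|i /ne -> //].
    by rewrite hc; ring.
  - by rewrite -[RHS]hs; apply: eq_bigr => i /ne ->.
(* the shortest resultant of the arms in E *)
pose d := Num.max 0 (r i2 - \sum_(i in F) r i).
have F0 : 0 <= \sum_(i in F) r i by apply: sumr_ge0 => i _; exact: ltW.
have ri2 := r0 i2.
have [d0 d1] : 0 <= d /\ r i2 - \sum_(i in F) r i <= d.
  by rewrite /d !le_max !lexx orbT.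
have [d2 d3 d4 d5] : [/\ d <= r i2 + \sum_(i in F) r i, d < g,
    d <= g - (r i0 - r i1) & g + d <= r i0 + r i1].
  by rewrite /d; case: (lerP 0 (r i2 - _)) => ?; split; lra.
have [||psi [pc ps]] := polygon r0 E0 d0.
- by rewrite (big_setD1 i2 i2E).
- move=> j jE; have [->|ji2] := eqVneq j i2; first by rewrite -/F; lra.
  rewrite (big_setD1 i2) /=; last by rewrite !inE eq_sym ji2 /=; move: i2E; rewrite !inE.
  have : 0 <= \sum_(i in E :\ j :\ i2) r i by apply: sumr_ge0 => i _; exact: ltW.
  by have := i2max j jE; lra.
apply: (crank_closable i0D i1D E0 pc ps d0 d3) => //.
by rewrite ger0_norm; lra.
Qed.

End Closable.

(** The second alternative says that one arm is longer than the bar and the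
    resultant of the other arms together. With r0 >= r1 the longest arms, it is
    what remains when r0 > g and aligning all arms but r0 and r1 fails. *)
Lemma arms_dichotomy (I : finType) (r l : I -> R) g : (2 < #|I|)%N ->
    (forall i, 0 < r i) -> (forall i, 0 < l i) -> g <= \sum_i r i ->
  closable r l [set: I]%SET g \/
  exists j (psi : I -> R) d, [/\ 0 <= d, g + d < r j,
    \sum_(i in [set: I]%SET :\ j) r i * cos (psi i) = d &
    \sum_(i in [set: I]%SET :\ j) r i * sin (psi i) = 0].
Proof.
move=> I3 r0 l0 gS; set D := [set: I]%SET.
have cD : #|D| = #|I| by rewrite cardsT.
have gD : g <= \sum_(i in D) r i.
  by rewrite (eq_bigl predT)// => i; rewrite inE.
have D0 : D != finset.set0 by rewrite -card_gt0 cD; apply: leq_trans I3.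
have [i0 i0D i0max] := max_in r D0.
have cD1 : #|D| = #|D :\ i0|.+1 by rewrite (cardsD1 i0) i0D.
have D10 : D :\ i0 != finset.set0 by rewrite -card_gt0; move: I3; rewrite -cD cD1; case: #|_|.
have [i1 i1D i1max] := max_in r D10.
have cD2 : #|D :\ i0| = #|D :\ i0 :\ i1|.+1 by rewrite (cardsD1 i1) i1D.
set E := D :\ i0 :\ i1 in cD2.
have E0 : E != finset.set0 by rewrite -card_gt0; move: I3; rewrite -cD cD1 cD2; case: #|_|.
have r10 : r i1 <= r i0 by apply: i0max; move: i1D; rewrite inE => /andP[].
have [h|h] := leP (\sum_(i in E) r i) (g - r i0 + r i1).
  by left; exact: (aligned_closable r0 l0 i0D i1D E0 r10 h gD).
have [h0|h0] := leP (r i0) g.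
  left; apply: (dominated_closable r0 l0 _ _ gD); first by rewrite cD.
  by move=> j /i0max /le_trans; apply.
(* the shortest resultant of the arms other than i0 *)
right; pose d := Num.max 0 (r i1 - \sum_(i in E) r i).
have ri1 := r0 i1; have re := sum_arms_gt0 r0 E0.
have [d0 d1 d2 d3] : [/\ 0 <= d, r i1 - \sum_(i in E) r i <= d, g + d < r i0
    & d <= r i1 + \sum_(i in E) r i].
  by rewrite /d; case: (lerP 0 (r i1 - _)) => ?; split; lra.
have [||psi [pc ps]] := polygon r0 D10 d0.
- by rewrite (big_setD1 i1 i1D).
- move=> j jD; have [->|ji1] := eqVneq j i1; first by rewrite -/E; lra.
  rewrite (big_setD1 i1) /=; last by rewrite !inE eq_sym ji1 /=; move: i1D; rewrite !inE.
  have : 0 <= \sum_(i in D :\ i0 :\ j :\ i1) r i by apply: sumr_ge0 => i _; exact: ltW.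
  by have := i1max j jD; lra.
by exists i0, psi, d.
Qed.

End Linkages.

(** * Roots of a continuous family of polynomials *)

Section Roots.
Variable C : numClosedFieldType.
Implicit Types (P Q : {poly C}) (u v : C).

Lemma exp_le_prod (T : eqType) (rs : seq T) (F : T -> C) (x : C) : 0 <= x ->
  (forall z, z \in rs -> x <= F z) -> x ^+ size rs <= \prod_(z <- rs) F z.
Proof.
move=> x0; elim: rs => [|z rs IH] h; first by rewrite big_nil.
rewrite big_cons exprS ler_pM ?exprn_ge0//; first by apply: h; rewrite mem_head.
by apply: IH => w wrs; apply: h; rewrite inE wrs orbT.
Qed.

Lemma norm_horner_roots P (rs : seq C) u :
  P = lead_coef P *: \prod_(z <- rs) ('X - z%:P) ->
  `|P.[u]| = `|lead_coef P| * \prod_(z <- rs) `|u - z|.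
Proof.
move=> PE; rewrite {1}PE hornerZ normrM horner_prod normr_prod.
by congr (_ * _); apply: eq_bigr => z _; rewrite hornerXsubC.
Qed.

Lemma norm_horner_diff N P Q u : 1 <= `|u| -> (size P <= N.+1)%N ->
    (size Q <= N.+1)%N ->
  `|P.[u] - Q.[u]| <= (\sum_(i < N.+1) `|P`_i - Q`_i|) * `|u| ^+ N.
Proof.
move=> u1 sP sQ; rewrite !(@horner_coef_wide _ N.+1)// -sumrB mulr_suml.
apply: (le_trans (ler_norm_sum _ _ _)); apply: ler_sum => i _.
rewrite -mulrBl normrM normrX ler_wpM2l//.
by apply: ler_weXn2l => //; rewrite -ltnS.
Qed.

Lemma size_roots P (rs : seq C) N : size P = N.+1 ->
  P = lead_coef P *: \prod_(z <- rs) ('X - z%:P) -> size rs = N.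
Proof.
move=> sP PE; have : size P = (size rs).+1.
  rewrite PE size_scale ?size_prod_XsubC// lead_coef_eq0 -size_poly_eq0 sP.
  by [].
by rewrite sP => -[].
Qed.

Lemma root_in_factors P (rs : seq C) N : size P = N.+1 ->
  P = lead_coef P *: \prod_(z <- rs) ('X - z%:P) -> forall v, root P v = (v \in rs).
Proof.
move=> sP PE v; rewrite PE rootZ ?root_prod_XsubC//.
by rewrite lead_coef_eq0 -size_poly_eq0 sP.
Qed.

(** If all roots of Q were in the closed unit disc, its factorisation would make
    |Q u| at least |lead Q| (|u| - 1)^N, but Q u is close to P u = 0. *)
Lemma far_root_persists N P Q u : size P = N.+1 -> size Q = N.+1 -> 1 < `|u| ->
    root P u ->
    (\sum_(i < N.+1) `|P`_i - Q`_i|) * `|u| ^+ N < `|lead_coef Q| * (`|u| - 1) ^+ N ->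
  exists2 v, root Q v & 1 < `|v|.
Proof.
move=> sP sQ u1 Pu lt; have [rs Qrs] := closed_field_poly_normal Q.
case: (boolP (has (fun v => 1 < `|v|) rs)) => [/hasP[v vrs v1]|/hasPn small].
  by exists v; rewrite ?(root_in_factors sQ Qrs).
suff /le_lt_trans/(_ lt) : `|lead_coef Q| * (`|u| - 1) ^+ N <=
    (\sum_(i < N.+1) `|P`_i - Q`_i|) * `|u| ^+ N by rewrite ltxx.
apply: le_trans (norm_horner_diff (ltW u1) _ _); rewrite ?sP ?sQ//.
rewrite (rootP Pu) sub0r normrN (norm_horner_roots u Qrs) ler_wpM2l//.
rewrite -(size_roots sQ Qrs) exp_le_prod// ?subr_ge0 ?ltW// => z /small.
rewrite -real_leNgt ?normr_real ?real1// => z1.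
by apply: le_trans (lerB_dist _ _); rewrite lerB.
Qed.

(** If the roots of P are at distance at least m inside the unit circle, its
    factorisation gives |P v| >= |lead P| (m |v|)^N for |v| >= 1, which a small
    change of the coefficients cannot cancel. *)
Lemma near_roots_stay N P : size P = N.+1 -> (forall v, root P v -> `|v| < 1) ->
  exists2 eta, 0 < eta & forall Q, (size Q <= N.+1)%N ->
    \sum_(i < N.+1) `|P`_i - Q`_i| < eta -> forall v, root Q v -> ~~ (1 <= `|v|).
Proof.
move=> sP small; have [rs Prs] := closed_field_poly_normal P.
have [m m0 mrs] : exists2 m : C, 0 < m & forall v, v \in rs -> m <= 1 - `|v|.
  have : {in rs, forall v, `|v| < 1} by move=> v; rewrite -(root_in_factors sP Prs) => /small.
  elim: rs {Prs} => [|v rs IH] h; first by exists 1.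
  have [|m m0 mrs] := IH; first by move=> w wrs; apply: h; rewrite inE wrs orbT.
  have v0 : 0 < 1 - `|v| by rewrite subr_gt0 h// mem_head.
  have mr : m \is Num.real by exact: gtr0_real.
  have vr : 1 - `|v| \is Num.real by exact: gtr0_real.
  have [h1|h1] := real_leP mr vr.
    by exists m => // w; rewrite inE => /predU1P[->|/mrs].
  exists (1 - `|v|) => // w; rewrite inE => /predU1P[->//|/mrs]; apply: le_trans.
  exact: ltW.
have lP : 0 < `|lead_coef P| by rewrite normr_gt0 lead_coef_eq0 -size_poly_eq0 sP.
exists (`|lead_coef P| * m ^+ N); first by rewrite mulr_gt0 ?exprn_gt0.
move=> Q sQ lt v Qv; apply/negP => v1.
have v0 : 0 < `|v| by apply: lt_le_trans v1.
have : `|lead_coef P| * m ^+ N * `|v| ^+ N <= (\sum_(i < N.+1) `|P`_i - Q`_i|) * `|v| ^+ N.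
  apply: le_trans (norm_horner_diff v1 _ _); rewrite ?sP//.
  rewrite (rootP Qv) subr0 (norm_horner_roots v Prs) -mulrA ler_wpM2l// -exprMn.
  rewrite -(size_roots sP Prs) exp_le_prod ?mulr_ge0 ?(ltW m0)// => z /mrs mz.
  apply: le_trans (lerB_dist _ _).
  rewrite -subr_ge0.
  have -> : `|v| - `|z| - m * `|v| = (1 - `|z| - m) * `|v| + `|z| * (`|v| - 1) by ring.
  by rewrite addr_ge0// mulr_ge0// subr_ge0.
by rewrite ler_pM2r ?exprn_gt0// lt_geF.
Qed.

End Roots.

(** The set of parameters for which all roots lie in the open disc is open by
    [near_roots_stay] and, as the circle is free of roots, closed by
    [far_root_persists]; the line is connected. *)
Lemma no_root_crossing (R : realType) (C : numClosedFieldType) (P : R -> {poly C})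
    (N : nat) (k : C) :
    (forall t, size (P t) = N.+1) -> (forall t, `|lead_coef (P t)| = k) ->
    (forall i, continuous (fun t => (P t)`_i)) ->
    (forall t u, `|u| = 1 -> ~~ root (P t) u) ->
    (forall u, 1 <= `|u| -> ~~ root (P 0) u) ->
  forall t u, 1 <= `|u| -> ~~ root (P t) u.
Proof.
move=> sP kP coefc circle start.
have Pc t (e : C) : 0 < e ->
    \forall s \near t, \sum_(i < N.+1) `|(P t)`_i - (P s)`_i| < e.
  move=> e0; have e1 : 0 < e / N.+1%:R by rewrite divr_gt0.
  have : \forall s \near t, forall i : 'I_N.+1, `|(P t)`_i - (P s)`_i| < e / N.+1%:R.
    apply: (@filter_forall _ _ (fun (i : 'I_N.+1) (s : R) =>
      `|(P t)`_i - (P s)`_i| < e / N.+1%:R) _ (nbhs_filter _)) => i.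
    by have /cvgrPdist_lt/(_ _ e1) := coefc i t.
  apply: filterS => s lt.
  apply: (@lt_le_trans _ _ (\sum_(i < N.+1) e / N.+1%:R)).
    apply: ltr_sum => //; first by apply/hasP; exists ord0; rewrite ?mem_index_enum.
  by rewrite sumr_const card_ord -[leLHS]mulr_natr divfK// pnatr_eq0.
pose K := [set t : R | forall u, 1 <= `|u| -> ~~ root (P t) u].
suff KT : K = setT by move=> t; have : K t by rewrite KT.
have k0 : 0 < k by rewrite -(kP 0) normr_gt0 lead_coef_eq0 -size_poly_eq0 sP.
have Kopen : open K.
  rewrite openE => t Kt; rewrite /interior.
  have [|e e0 stay] := near_roots_stay (sP t).
    move=> v Pv; rewrite real_ltNge ?normr_real ?real1//.
    by apply: contraL Pv => /Kt.
  near=> s => u u1; apply/negP => Pu.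
  have := stay (P s) _ _ _ Pu; rewrite u1 => /(_ _ _)/negP; apply=> //.
    by rewrite sP.
  by near: s; exact: Pc.
have Kclosed : closed K.
  rewrite -openC openE => t /= nKt; rewrite /interior.
  have [u u1 Pu] : exists2 u, 1 <= `|u| & root (P t) u.
    by apply: contrapT => h; apply: nKt => u u1; apply/negP => Pu; apply: h; exists u.
  have {}u1 : 1 < `|u|.
    by rewrite lt_neqAle u1 andbT; apply: contraL Pu => /eqP /esym u1E; exact: circle.
  pose e := k * (`|u| - 1) ^+ N / `|u| ^+ N.
  have u0 : 0 < `|u| by apply: lt_trans u1.
  have e0 : 0 < e by rewrite divr_gt0 ?mulr_gt0 ?exprn_gt0 ?subr_gt0.
  near=> s => Ks.
  have [|v Pv v1] := far_root_persists (sP t) (sP s) u1 Pu.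
    by rewrite kP -ltr_pdivlMr ?exprn_gt0//; near: s; exact: Pc.
  by have := Ks v (ltW v1); rewrite Pv.
have : connected [set: R] by apply/connected_intervalP.
apply; first by exists 0; exact: start.
- by exists K; rewrite ?setTI.
- by exists K; rewrite ?setTI.
Unshelve. all: end_near. Qed.

(** * Affine coordinates on a lattice simplex *)

Definition dotm (S : comNzRingType) n (w : 'I_n -> S) (m : multinom n) : S :=
  \sum_i w i * (m i)%:R.

Lemma dotmB (S : comNzRingType) n (w v : 'I_n -> S) m :
  dotm (fun i => w i - v i) m = dotm w m - dotm v m.
Proof. by rewrite /dotm -sumrB; apply: eq_bigr => i _; rewrite mulrBl. Qed.

Lemma dotmD (S : comNzRingType) n (w v : 'I_n -> S) m :
  dotm (fun i => w i + v i) m = dotm w m + dotm v m.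
Proof. by rewrite /dotm -big_split; apply: eq_bigr => i _; rewrite mulrDl. Qed.

Lemma dotmZ (S : comNzRingType) n k (v : 'I_n -> S) m : dotm (fun i => k * v i) m = k * dotm v m.
Proof. by rewrite /dotm mulr_sumr; apply: eq_bigr => i _; rewrite mulrA. Qed.

(** Affine functions on R^n are column vectors (k, w), and this matrix evaluates
    them at the vertices. *)
Definition vertex_mx (S : comNzRingType) n (alpha : 'I_n.+1 -> multinom n) : 'M[S]_n.+1 :=
  row_mx (const_mx 1 : 'cV_n.+1) (\matrix_(j, i) (alpha j i)%:R).

Lemma vertex_mx_mul (S : comNzRingType) n (alpha : 'I_n.+1 -> multinom n)
    (X : 'cV[S]_n.+1) j :
  (vertex_mx S alpha *m X) j 0 = X 0 0 + dotm (fun i => X (lift 0 i) 0) (alpha j).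
Proof.
rewrite mxE big_ord_recl; congr (_ + _).
  by rewrite mxE; case: splitP => // k _; rewrite mxE mul1r.
apply: eq_bigr => i _; rewrite mulrC; congr (_ * _).
rewrite mxE; case: splitP => [[[|//] /=]|k] /=; rewrite /bump//= add1n.
by move=> /eqP; rewrite eqSS => /eqP /val_inj <-; rewrite mxE.
Qed.

Section Simplex.
Variables (R : realType) (n : nat) (alpha : 'I_n.+1 -> multinom n).
Hypothesis indep : affinely_independent (fun j => mnm_point R (alpha j)).

Lemma vertex_mx_unit : vertex_mx R alpha \in unitmx.
Proof.
rewrite -row_free_unit; apply: inj_row_free => v vM.
have vE k : \sum_j v 0 j * vertex_mx R alpha j k = 0.
  by move/matrixP : vM => /(_ 0 k); rewrite !mxE.
apply/rowP => j; rewrite mxE; apply: (indep (mu := v 0)).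
  rewrite -[RHS](vE 0); apply: eq_bigr => k _.
  by rewrite mxE; case: splitP => // l _; rewrite mxE mulr1.
apply/rowP => i; rewrite summxE mxE -[RHS](vE (lift 0 i)); apply: eq_bigr => k _.
rewrite !mxE; congr (_ * _).
case: splitP => [[[|//] /=]|l] /=; rewrite /bump//= add1n.
by move=> /eqP; rewrite eqSS => /eqP /val_inj <-; rewrite mxE.
Qed.

Lemma affine_interp (phi : 'I_n.+1 -> R) :
  exists k (w : 'I_n -> R), forall j, k + dotm w (alpha j) = phi j.
Proof.
pose X := invmx (vertex_mx R alpha) *m \col_j phi j.
exists (X 0 0), (fun i => X (lift 0 i) 0) => j.
by rewrite -vertex_mx_mul mulmxA mulmxV ?vertex_mx_unit// mul1mx mxE.
Qed.

Lemma affine_coords (phi : 'I_n.+1 -> R) k (w : 'I_n -> R) :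
  (forall j, k + dotm w (alpha j) = phi j) ->
  forall i, w i = \sum_j invmx (vertex_mx R alpha) (lift 0 i) j * phi j.
Proof.
move=> h i; pose X : 'cV[R]_n.+1 := \col_l if unlift 0 l is Some i then w i else k.
have MX : vertex_mx R alpha *m X = \col_j phi j.
  apply/colP => j; rewrite vertex_mx_mul [RHS]mxE -h mxE unlift_none; congr (_ + _).
  by apply: eq_bigr => l _; rewrite mxE liftK.
have : X = invmx (vertex_mx R alpha) *m \col_j phi j.
  by rewrite -MX mulmxA mulVmx ?vertex_mx_unit// mul1mx.
move/colP => /(_ (lift 0 i)); rewrite !mxE liftK => ->.
by apply: eq_bigr => j _; rewrite mxE.
Qed.

Lemma dotm_eq0 (w : 'I_n -> R) k : (forall j, k + dotm w (alpha j) = 0) ->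
  forall i, w i = 0.
Proof.
by move=> h i; rewrite (affine_coords h) big1// => j _; rewrite mulr0.
Qed.

(** The adjugate of the integral vertex matrix solves the system that defines the
    affine function supported at one vertex up to the determinant, without
    leaving the integers. *)
Lemma integral_cocharacter (j0 : 'I_n.+1) :
  exists (N : nat) (k : int) (m : 'I_n -> int), (0 < N)%N /\
    forall j, k + dotm m (alpha j) = if j == j0 then N%:Z else 0.
Proof.
pose M := vertex_mx int alpha.
have ME : vertex_mx R alpha = map_mx intr M.
  apply/matrixP => j l; rewrite !mxE; case: splitP => l' _; rewrite !mxE//.
  by rewrite rmorph_nat.
have D0 : \det M != 0.
  have := vertex_mx_unit; rewrite unitmxE ME det_map_mx unitfE.
  by apply: contra => /eqP ->; rewrite rmorph0.
pose X : 'cV[int]_n.+1 := sgz (\det M) *: (\adj M *m delta_mx j0 0).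
exists `|\det M|%N, (X 0 0), (fun i => X (lift 0 i) 0); split.
  by rewrite absz_gt0.
move=> j; rewrite -vertex_mx_mul -/M /X -scalemxAr mulmxA mul_mx_adj mul_scalar_mx !mxE.
by rewrite abszE normrEsg sgrz mulrA; case: eqP => //= _; rewrite ?mulr1// mulr0.
Qed.

Section Barycentric.
Variables (y : multinom n) (lam : 'I_n.+1 -> R).
Hypothesis lamP : convex_coords (fun j => mnm_point R (alpha j)) (mnm_point R y) lam.

Lemma dotm_barycentric (w : 'I_n -> R) :
  dotm w y = \sum_j lam j * dotm w (alpha j).
Proof.
case: lamP => _ _ yE.
under eq_bigr do rewrite mulr_sumr.
rewrite exchange_big; apply: eq_bigr => i _ /=.
have -> : (y i)%:R = mnm_point R y 0 i by rewrite mxE.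
rewrite yE summxE mulr_sumr; apply: eq_bigr => j _.
by rewrite !mxE mulrCA.
Qed.

(** The weighted sum of the phi_j is the value at y of their affine interpolation,
    so under this constraint its constant term is - <w, y>. *)
Lemma circuit_interp (phi : 'I_n.+1 -> R) : \sum_j lam j * phi j = 0 ->
  exists w : 'I_n -> R, forall j, dotm w (alpha j) - dotm w y = phi j.
Proof.
move=> phi0; have [k [w h]] := affine_interp phi; exists w => j.
have : k + dotm w y = 0.
  rewrite -phi0; under [RHS]eq_bigr => l do rewrite -h mulrDr.
  by rewrite big_split -mulr_suml/= -dotm_barycentric; case: lamP => _ -> _; rewrite mul1r.
by rewrite -h => /eqP; rewrite addrC addr_eq0 => /eqP ->; rewrite opprK addrC.
Qed.

Lemma circuit_eq0 (w : 'I_n -> R) :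
  (forall j, dotm w (alpha j) - dotm w y = 0) -> forall i, w i = 0.
Proof.
by move=> h; apply: (@dotm_eq0 _ (- dotm w y)) => j; rewrite addrC.
Qed.

Hypothesis y_int : interior (conv_hull (fun j => mnm_point R (alpha j))) (mnm_point R y).

(** If lam j = 0, moving y slightly away from the vertex j makes the coordinate j
    negative, so the moved point leaves the hull. *)
Lemma barycentric_gt0 j : 0 < lam j.
Proof.
case: lamP => lam0 lam1 yE; rewrite lt_neqAle lam0 andbT eq_sym; apply/eqP => lj0.
pose v k := mnm_point R (alpha k).
(* at f e, the coordinate j is - e *)
pose f (e : R) := mnm_point R y - e *: (v j - mnm_point R y).
have fc : f @ (0 : R) --> mnm_point R y.
  rewrite -[X in _ --> X]subr0 -[X in _ - X](scale0r (v j - mnm_point R y)).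
  apply: cvgB; first exact: cvg_cst.
  by apply: cvgZr_tmp; exact: cvg_id.
have [e [e0 [mu [mu0 mu1 fE]]]] : exists e, 0 < e /\ conv_hull v (f e).
  near (0 : R)^'+ => e; exists e; split; first by near: e; exact: nbhs_right_gt.
  by near: e; exact: (cvg_at_right_filter fc y_int).
pose nu k := mu k - ((1 + e) * lam k - e * (k == j)%:R).
have sum_delta (V : lmodType R) (F : 'I_n.+1 -> V) : \sum_k (k == j)%:R *: F k = F j.
  rewrite (bigD1 j)//= eqxx scale1r big1 ?addr0// => k /negbTE ->; exact: scale0r.
have : nu j = 0.
  apply: indep.
    rewrite !sumrB mu1 -!mulr_sumr lam1.
    have := sum_delta R^o (fun=> 1); under eq_bigr do rewrite /GRing.scale/= mulr1.
    by move=> ->; ring.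
  under eq_bigr do rewrite !scalerBl -!scalerA.
  rewrite !sumrB -!scaler_sumr -fE sum_delta -yE /f.
  by apply/rowP => i; rewrite !mxE; ring.
rewrite /nu eqxx lj0 mulr0 sub0r opprK mulr1 => h.
by have := mu0 j; move: h => /eqP; rewrite addr_eq0 => /eqP ->; rewrite oppr_ge0 leNgt e0.
Unshelve. all: end_near. Qed.

Lemma barycentric_lt1 j : (0 < n)%N -> lam j < 1.
Proof.
move=> n0; have [k kj] : exists k, k != j.
  have [->|] := eqVneq j ord0; last by exists ord0; rewrite eq_sym.
  by exists ord_max; rewrite -val_eqE/= -lt0n.
case: lamP => _ <- _; rewrite (bigD1 j)//= (bigD1 k)//= ltrDl.
rewrite ltr_pwDl ?barycentric_gt0// sumr_ge0// => l _.
exact/ltW/barycentric_gt0.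
Qed.

(** If y i = 0, the vertices all have coordinate i equal to 0 by positivity, so
    they lie in a hyperplane. *)
Lemma interior_exponent_gt0 i : (0 < y i)%N.
Proof.
rewrite lt0n; apply/negP => /eqP yi0.
pose w k : R := (k == i)%:R.
have dw m : dotm w m = (m i)%:R.
  rewrite /dotm (bigD1 i)//= /w eqxx mul1r big1 ?addr0// => k /negbTE ->.
  by rewrite mul0r.
have := dotm_barycentric w; rewrite dw yi0 => /esym/psumr_eq0P h.
suff /(_ i) : forall k, w k = 0 by rewrite /w eqxx => /eqP; rewrite oner_eq0.
apply: (@dotm_eq0 w 0) => j; rewrite add0r.
have /eqP : lam j * dotm w (alpha j) = 0.
  by apply: h => // k _; rewrite mulr_ge0 ?dw ?ler0n ?(ltW (barycentric_gt0 k)).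
by rewrite mulf_eq0 gt_eqF ?barycentric_gt0//= => /eqP.
Qed.

End Barycentric.
End Simplex.

(** * Monomials at real points *)

Definition mono (S : comNzRingType) n (x : 'I_n -> S) (m : multinom n) : S :=
  \prod_i x i ^+ m i.

Lemma meval_circuit (R : realType) n (alpha : 'I_n.+1 -> multinom n) y b c (x : 'I_n -> R) :
  meval x (circuit_poly alpha y b c) = \sum_j b 0 j * mono x (alpha j) + c * mono x y.
Proof.
rewrite /circuit_poly mevalD mevalZ mevalX raddf_sum/=; congr (_ + _).
by apply: eq_bigr => j _; rewrite mevalZ mevalX.
Qed.

Lemma mono_expR (R : realType) n (w : 'I_n -> R) m :
  mono (fun i => expR (w i)) m = expR (dotm w m).
Proof.
by rewrite /mono /dotm expR_sum; apply: eq_bigr => i _; rewrite -expRM_natr.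
Qed.

Lemma monoM (S : comNzRingType) n (x z : 'I_n -> S) m :
  mono (fun i => x i * z i) m = mono x m * mono z m.
Proof. by rewrite /mono -big_split; apply: eq_bigr => i _; rewrite exprMn. Qed.

Lemma mono_sign_even (S : comNzRingType) n (s : 'I_n -> S) m :
  (forall i, s i = 1 \/ s i = -1) -> even_mnm m -> mono s m = 1.
Proof.
move=> s1 /forallP ev; rewrite /mono big1// => i _.
by case: (s1 i) => ->; rewrite ?expr1n// -signr_odd (negbTE (ev i)).
Qed.

Lemma mono_sign (S : comNzRingType) n (s : 'I_n -> S) m :
  (forall i, s i = 1 \/ s i = -1) -> mono s m = 1 \/ mono s m = -1.
Proof.
move=> s1; rewrite /mono; elim/big_ind: _ => [|x z|i _]; first by left.
- by case=> -> [] ->; rewrite ?mulr1 ?mul1r ?mulrNN ?mul1r; [left|right|right|left].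
- case: (s1 i) => ->; first by rewrite expr1n; left.
  by rewrite -signr_odd; case: odd; [right|left].
Qed.

Lemma sign_vector_odd (S : comNzRingType) n (m : multinom n) : ~~ even_mnm m ->
  exists2 s : 'I_n -> S, forall i, s i = 1 \/ s i = -1 & mono s m = -1.
Proof.
move=> /forallPn[i /negPn oi]; exists (fun k => if k == i then -1 else 1).
  by move=> k; case: eqP; [right|left].
rewrite /mono (bigD1 i)//= eqxx big1 ?mulr1; first by rewrite -signr_odd oi.
by move=> k /negbTE ->; rewrite expr1n.
Qed.

Lemma mono_even_ge0 (R : realType) n (x : 'I_n -> R) m : even_mnm m -> 0 <= mono x m.
Proof.
by move=> /forallP ev; apply: prodr_ge0 => i _; rewrite exprn_even_ge0.
Qed.

Lemma real_polar (R : realType) n (x : 'I_n -> R) : (forall i, x i != 0) ->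
  exists2 s : 'I_n -> R, forall i, s i = 1 \/ s i = -1 &
    forall i, x i = s i * expR (ln `|x i|).
Proof.
move=> x0; exists (fun i => Num.sg (x i)) => i.
  by have := x0 i; rewrite neq_lt => /orP[/ltr0_sg|/gtr0_sg] ->; [right|left].
by rewrite lnK ?posrE ?normr_gt0// -numEsg.
Qed.

(** Coefficients of coinciding monomials add up, and they are all positive. *)
Lemma circuit_squares (R : realType) n (alpha : 'I_n.+1 -> multinom n) y
    (b : 'rV[R]_n.+1) c : (forall j, even_mnm (alpha j)) -> even_mnm y ->
    (forall j, 0 < b 0 j) -> 0 < c ->
  sum_of_monomial_squares (circuit_poly alpha y b c).
Proof.
move=> ae ye b0 c0 m; rewrite mcoeff_msupp /circuit_poly mcoeffD mcoeffZ mcoeffX.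
rewrite raddf_sum /=; under eq_bigr do rewrite mcoeffZ mcoeffX.
have S0 : 0 <= \sum_j b 0 j * (alpha j == m)%:R.
  by apply: sumr_ge0 => j _; rewrite mulr_ge0// ltW.
have [ym|_] := eqVneq y m.
  by rewrite mulr1 => _; split; [rewrite ltr_wpDl|rewrite -ym].
rewrite mulr0 addr0 => Sn0; split; first by rewrite lt_neqAle eq_sym Sn0.
have /existsP[j /eqP <-] : [exists j, alpha j == m]; last exact: ae.
apply: contraNT Sn0 => /existsPn h; rewrite big1// => j _.
by rewrite (negbTE (h j)) mulr0.
Qed.

(** * Convergence and components in spaces of row vectors *)

Lemma cvg_sumr (K : numFieldType) (T : Type) (F : set_system T) (FF : Filter F)
    (I : finType) (f : I -> T -> K) (a : I -> K) :
  (forall i, f i @ F --> a i) -> (fun x => \sum_i f i x) @ F --> \sum_i a i.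
Proof. by move=> fa; apply: cvg_big => [|i _]; [exact: add_continuous|exact: fa]. Qed.

Lemma coef_continuous (R : realType) n (q : 'rV[R]_n.+1 * R) j :
  (fun p : 'rV[R]_n.+1 * R => p.1 0 j) @ q --> q.1 0 j.
Proof.
apply: (@cvg_comp _ _ _ fst (fun v : 'rV[R]_n.+1 => v 0 j)); first exact: cvg_fst.
exact: coord_continuous.
Qed.

Lemma row_norm_le (R : realType) n (w : 'rV[R]_n) M : 0 <= M ->
  (forall i, `|w 0 i| <= M) -> `|w| <= M.
Proof.
move=> M0 h; rewrite /Num.norm/= mx_normrE; apply: bigmax_le => // -[i j] _ /=.
by rewrite ord1.
Qed.

Lemma row_norm_ge (R : realType) n (w : 'rV[R]_n) i : `|w 0 i| <= `|w|.
Proof.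
by rewrite [leRHS]/Num.norm/= mx_normrE; apply: (le_bigmax _ _ (0, i)).
Qed.

Lemma ray_unbounded (R : realType) n (A : set 'rV[R]_n) (w v : 'rV[R]_n) : v != 0 ->
    (forall s, 0 <= s -> ~ A (w + s *: v)) ->
  ~ bounded_set (connected_component (~` A) w).
Proof.
move=> v0 ray [M [Mr bnd]].
have /existsP[i vi0] : [exists i, v 0 i != 0].
  apply: contraNT v0 => /existsPn h; apply/eqP/rowP => i; rewrite mxE.
  by apply/eqP; have := h i; rewrite negbK.
have vi : 0 < `|v 0 i| by rewrite normr_gt0.
pose K := `|M| + 1.
pose s := (K + `|w 0 i| + 1) / `|v 0 i|.
have K0 : 0 <= K by rewrite addr_ge0.
have s0 : 0 <= s by rewrite divr_ge0// !addr_ge0.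
have := bnd K; rewrite /K => /(_ _ (w + s *: v))/=; set C := connected_component _ _.
have Cray : C (w + s *: v).
  pose f (t : R) : 'rV[R]_n := w + t *: v.
  have fc : continuous f.
    move=> t; apply: cvgD; first exact: cvg_cst.
    by apply: cvgZr_tmp; exact: cvg_id.
  have : (f @` `[0, +oo[) `<=` C.
    apply: connected_component_max.
    - by exists 0; rewrite /f ?scale0r ?addr0//= in_itv/= lexx.
    - by move=> _ [t + <-]; rewrite /= in_itv/= andbT => /ray.
    - apply: connected_continuous_connected; last exact: continuous_subspaceT.
      by apply/connected_intervalP; exact: interval_is_interval.
  by apply; exists s => //=; rewrite in_itv/= s0.
have MK : M < `|M| + 1 by have := ler_norm M; lra.
move=> /(_ MK Cray); apply/negP; rewrite -ltNge.
apply: lt_le_trans (row_norm_ge _ i); rewrite !mxE addrC.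
apply: lt_le_trans (lerB_normD _ _).
have -> : `|s * v 0 i| = `|M| + 1 + `|w 0 i| + 1 by rewrite normrM (ger0_norm s0) divfK ?gt_eqF.
lra.
Qed.

(** * Complex points and the amoeba *)

Section Cis.
Variable R : realType.
Implicit Types (t : R) (z : R[i]).
Local Notation RtoC := (real_complex R).

Definition cis t : R[i] := Complex (cos t) (sin t).

Lemma cis0 : cis 0 = 1. Proof. by rewrite /cis cos0 sin0. Qed.

Lemma cisD t s : cis (t + s) = cis t * cis s.
Proof.
rewrite /cis cosD sinD; apply/eqP; rewrite eq_complex /=.
by apply/andP; split; apply/eqP; ring.
Qed.

Lemma cisXn t k : cis t ^+ k = cis (t * k%:R).
Proof.
elim: k => [|k IH]; first by rewrite mulr0 cis0.
by rewrite exprS IH -cisD mulrSr mulrDr mulr1 addrC.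
Qed.

Lemma normc_cis t : ComplexField.Normc.normc (cis t) = 1.
Proof. by rewrite /= cos2Dsin2 sqrtr1. Qed.

Lemma norm_complexE z : `|z| = RtoC (ComplexField.Normc.normc z).
Proof. by case: z => a b; rewrite normc_def. Qed.

Lemma norm_cis t : `|cis t| = 1.
Proof. by rewrite norm_complexE normc_cis. Qed.

Lemma normc_RtoC (x : R) : ComplexField.Normc.normc (RtoC x) = `|x|.
Proof. by rewrite /= expr0n addr0 sqrtr_sqr. Qed.

Lemma norm_RtoC (x : R) : `|RtoC x| = RtoC `|x|.
Proof. by rewrite norm_complexE normc_RtoC. Qed.

Lemma polar z : exists t, z = RtoC (ComplexField.Normc.normc z) * cis t.
Proof.
have [->|z0] := eqVneq z 0.
  by exists 0; rewrite ComplexField.Normc.normc0 rmorph0 mul0r.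
pose r := ComplexField.Normc.normc z.
have r0 : 0 < r.
  rewrite lt_neqAle eq_sym; apply/andP; split; last first.
    by rewrite /r; case: (z) => a b /=; exact: sqrtr_ge0.
  by apply: contra z0 => /eqP/ComplexField.Normc.eq0_normc ->.
case: z z0 @r r0 => a b z0 r r0.
have r2 : r ^+ 2 = a ^+ 2 + b ^+ 2 by rewrite /r /= sqr_sqrtr// addr_ge0// sqr_ge0.
have rab : (a / r) ^+ 2 + (b / r) ^+ 2 = 1.
  by rewrite !expr_div_n -mulrDl -r2 divff// expf_neq0// gt_eqF.
have aI : -1 <= a / r <= 1.
  rewrite -ler_norml -(ler_pXn2r (ltn0Sn 1)) ?nnegrE// expr1n real_normK ?num_real//.
  by rewrite -rab lerDl sqr_ge0.
have sE : sin (acos (a / r)) = `|b / r|.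
  by rewrite sin_acos// -rab addrAC subrr add0r sqrtr_sqr.
have cE : cos (acos (a / r)) = a / r by rewrite acosK.
have main t : cos t = a / r -> sin t = b / r -> Complex a b = RtoC r * cis t.
  move=> ct st; apply/eqP; rewrite eq_complex /= ct st; apply/andP; split; apply/eqP; field;
  by rewrite gt_eqF.
case: (ger0P (b / r)) sE => _ sE; first by exists (acos (a / r)); exact: main.
by exists (- acos (a / r)); apply: main; rewrite ?cosN// sinN sE opprK.
Qed.

Lemma cis_continuous : continuous (cis : R -> (R[i] : numFieldType)).
Proof.
move=> t; apply/cvgrPdist_lt => e e0.
have [e' eE] : exists e', e = real_complex R e'.
  by exists (complex.Re e); case: e e0 => a b; rewrite ltcE /= => /andP[/eqP-> _].
have e'0 : 0 < e' by move: e0; rewrite eE ltcR.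
have hc : \forall s \near t, `|cos t - cos s| < e' / 2.
  by have /cvgrPdist_lt/(_ (e' / 2)) := @continuous_cos R t; apply; rewrite divr_gt0.
have hs : \forall s \near t, `|sin t - sin s| < e' / 2.
  by have /cvgrPdist_lt/(_ (e' / 2)) := @continuous_sin R t; apply; rewrite divr_gt0.
near=> s.
have cs : `|cos t - cos s| < e' / 2 by near: s.
have ss : `|sin t - sin s| < e' / 2 by near: s.
rewrite eE normc_def /= ltcR.
apply: (@le_lt_trans _ _ (`|cos t - cos s| + `|sin t - sin s|)); last by lra.
rewrite -[leRHS]ger0_norm ?addr_ge0// -sqrtr_sqr ler_wsqrtr//.
have sq (x : R) : x ^+ 2 = `|x| ^+ 2 by rewrite real_normK ?num_real.
rewrite (sq (cos t - _)) (sq (sin t - _)) sqrrD [leRHS]addrAC lerDl.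
by rewrite mulrn_wge0// mulr_ge0.
Unshelve. all: end_near. Qed.

Lemma sum_cis (I : finType) (Q : pred I) (r phi : I -> R) :
  \sum_(j | Q j) RtoC (r j) * cis (phi j) =
  Complex (\sum_(j | Q j) r j * cos (phi j)) (\sum_(j | Q j) r j * sin (phi j)).
Proof.
elim/big_rec3: _ => // j c1 c2 z _ ->.
by apply/eqP; rewrite eq_complex /= !mul0r subr0 addr0 !eqxx.
Qed.

Lemma mono_cis n (th : 'I_n -> R) m : mono (fun i => cis (th i)) m = cis (dotm th m).
Proof.
rewrite /mono /dotm; elim/big_rec2: _ => [|i x t _ ->]; first by rewrite cis0.
by rewrite cisXn -cisD.
Qed.

Lemma mono_RtoC n (x : 'I_n -> R) m : mono (fun i => RtoC (x i)) m = RtoC (mono x m).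
Proof. by rewrite /mono rmorph_prod; apply: eq_bigr => i _; rewrite rmorphXn. Qed.

Lemma meval_complex_circuit n (alpha : 'I_n.+1 -> multinom n) y b c (z : 'I_n -> R[i]) :
  meval z (map_mpoly RtoC (circuit_poly alpha y b c)) =
  \sum_j RtoC (b 0 j) * mono z (alpha j) + RtoC c * mono z y.
Proof.
have E a m : meval z (map_mpoly RtoC (a *: mpolyX R m)) = RtoC a * mono z m.
  by rewrite map_mpolyZ map_mpolyX mevalZ mevalX.
rewrite /circuit_poly rmorphD mevalD; congr (_ + _); last exact: E.
rewrite (raddf_sum (map_mpoly RtoC)) raddf_sum; apply: eq_bigr => j _; exact: E.
Qed.

(** The value of the circuit polynomial at the point exp(w + i th). *)
Definition fiber n (alpha : 'I_n.+1 -> multinom n) y (b : 'rV[R]_n.+1) c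
    (w th : 'I_n -> R) : R[i] :=
  \sum_j RtoC (b 0 j * expR (dotm w (alpha j))) * cis (dotm th (alpha j))
  + RtoC (c * expR (dotm w y)) * cis (dotm th y).

Lemma amoebaP n (alpha : 'I_n.+1 -> multinom n) y (b : 'rV[R]_n.+1) c (w : 'rV[R]_n) :
  amoeba (circuit_poly alpha y b c) w <-> exists th, fiber alpha y b c (w 0) th = 0.
Proof.
have key w' th : meval (fun i => RtoC (expR (w' i)) * cis (th i))
    (map_mpoly RtoC (circuit_poly alpha y b c)) = fiber alpha y b c w' th.
  have mE m : mono (fun i => RtoC (expR (w' i)) * cis (th i)) m =
      RtoC (expR (dotm w' m)) * cis (dotm th m).
    by rewrite monoM mono_RtoC mono_expR mono_cis.
  rewrite meval_complex_circuit /fiber mE rmorphM -mulrA; congr (_ + _).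
  by apply: eq_bigr => j _; rewrite mE rmorphM -mulrA.
split=> [[z [z0 fz wE]]|[th fth]].
  have /choice[th zE] : forall i, exists t, z i = RtoC (ComplexField.Normc.normc (z i)) * cis t.
    by move=> i; exact: polar.
  exists th; rewrite -key -[RHS]fz; apply: meval_eq => i.
  rewrite wE mxE lnK -?zE// posrE lt_neqAle eq_sym.
  rewrite (contra_neq _ (z0 i)) => [|/ComplexField.Normc.eq0_normc//].
  by case: (z i) => a b' /=; rewrite sqrtr_ge0.
exists (fun i => RtoC (expR (w 0 i)) * cis (th i)); split.
- move=> i; rewrite -normr_gt0 normrM norm_cis mulr1 norm_RtoC gtr0_norm ?expR_gt0//.
  by rewrite ltcR expR_gt0.
- by rewrite key.
- apply/rowP => i; rewrite mxE ComplexField.Normc.normcM normc_cis mulr1 normc_RtoC.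
  by rewrite gtr0_norm ?expR_gt0// expRK.
Qed.

End Cis.

(** * Nonnegative circuit polynomials and their amoebas *)

Section Circuit.
Variables (R : realType) (n : nat).
Variables (alpha : 'I_n.+1 -> multinom n) (y : multinom n) (b : 'rV[R]_n.+1).
Variable (lam : 'I_n.+1 -> R).
Hypothesis indep : affinely_independent (fun j => mnm_point R (alpha j)).
Hypothesis alpha_even : forall j, even_mnm (alpha j).
Hypothesis y_int : interior (conv_hull (fun j => mnm_point R (alpha j))) (mnm_point R y).
Hypothesis b_gt0 : forall j, 0 < b 0 j.
Hypothesis lamP : convex_coords (fun j => mnm_point R (alpha j)) (mnm_point R y) lam.

Local Notation Theta := (circuit_number lam b).
Local Notation lam_gt0 := (barycentric_gt0 indep lamP y_int).

(** The part of f / x^y that comes from the vertices, at x = exp w. *)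
Definition gsum (w : 'I_n -> R) : R :=
  \sum_j b 0 j * expR (dotm w (alpha j) - dotm w y).

Lemma gsumE w : \sum_j b 0 j * expR (dotm w (alpha j)) = expR (dotm w y) * gsum w.
Proof.
rewrite /gsum mulr_sumr; apply: eq_bigr => j _.
by rewrite mulrCA -expRD addrC subrK.
Qed.

Lemma circuit_numberE : Theta = expR (\sum_j lam j * ln (b 0 j / lam j)).
Proof.
rewrite expR_sum; apply: eq_bigr => j _.
by rewrite /powR gt_eqF// divr_gt0// lam_gt0.
Qed.

Lemma circuit_number_gt0 : 0 < Theta.
Proof. by rewrite circuit_numberE expR_gt0. Qed.

(** The point where the weighted arithmetic and geometric means of the terms
    agree. *)
Lemma equilibrium : exists w : 'I_n -> R, forall j,
  b 0 j * expR (dotm w (alpha j) - dotm w y) = lam j * Theta.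
Proof.
have T0 := circuit_number_gt0.
have [|w wE] := circuit_interp indep lamP (phi := fun j => ln Theta - ln (b 0 j / lam j)).
  under eq_bigr do rewrite mulrBr.
  rewrite sumrB -mulr_suml; case: lamP => _ -> _.
  by rewrite mul1r circuit_numberE expRK subrr.
exists w => j; have l0 := lam_gt0 j.
by rewrite wE expRB !lnK ?posrE ?divr_gt0//; field; rewrite !gt_eqF.
Qed.

Lemma gsum_equilibrium ws : (forall j,
  b 0 j * expR (dotm ws (alpha j) - dotm ws y) = lam j * Theta) -> gsum ws = Theta.
Proof.
move=> wsE; rewrite /gsum (eq_bigr _ (fun j _ => wsE j)) -mulr_suml.
by case: lamP => _ -> _; rewrite mul1r.
Qed.

(** Relative to the equilibrium, gsum is Theta times a convex combination of
    exponentials whose exponents average to 0; compare each with its tangent. *)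
Lemma gsum_min ws w : (forall j,
    b 0 j * expR (dotm ws (alpha j) - dotm ws y) = lam j * Theta) ->
  Theta <= gsum w /\ (gsum w = Theta -> w =1 ws).
Proof.
move=> wsE; have T0 := circuit_number_gt0.
pose v i := w i - ws i.
pose u j := dotm v (alpha j) - dotm v y.
have gE : gsum w = Theta * \sum_j lam j * expR (u j).
  rewrite /gsum mulr_sumr; apply: eq_bigr => j _.
  rewrite mulrA (mulrC Theta) -wsE -mulrA -expRD; congr (_ * expR _).
  by rewrite /u /v !dotmB; ring.
have u0 : \sum_j lam j * u j = 0.
  under eq_bigr do rewrite mulrBr.
  rewrite sumrB -(dotm_barycentric lamP) -mulr_suml.
  by case: lamP => _ -> _; rewrite mul1r subrr.
have l1 : \sum_j lam j * (1 + u j) = 1.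
  under eq_bigr do rewrite mulrDr mulr1.
  by rewrite big_split/= u0 addr0; case: lamP.
have le j : lam j * (1 + u j) <= lam j * expR (u j).
  by rewrite ler_wpM2l ?expR_ge1Dx// ltW// lam_gt0.
split; first by rewrite gE ler_peMr ?(ltW T0)// -l1 ler_sum.
move=> gT.
have h : \sum_j (lam j * expR (u j) - lam j * (1 + u j)) = 0.
  rewrite sumrB l1; apply/eqP; rewrite subr_eq0 -(inj_eq (mulfI (lt0r_neq0 T0))) -gE mulr1.
  exact/eqP.
have uj j : u j = 0.
  apply: contrapT => /eqP uj0.
  have := psumr_eq0P _ h => /(_ _ j isT)/eqP.
  rewrite -mulrBr mulf_eq0 gt_eqF ?lam_gt0//= gt_eqF ?subr_gt0 ?expR_gt1Dx//.
  by move=> H; suff: false by []; apply: H => i _; rewrite subr_ge0.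
by move=> i; apply/eqP; rewrite -subr_eq0; apply/eqP; exact: (circuit_eq0 indep uj).
Qed.

Lemma meval_signed_exp c (s w : 'I_n -> R) : (forall i, s i = 1 \/ s i = -1) ->
  meval (fun i => s i * expR (w i)) (circuit_poly alpha y b c) =
  expR (dotm w y) * (gsum w + c * mono s y).
Proof.
move=> s1; rewrite meval_circuit mulrDr -gsumE; congr (_ + _).
  apply: eq_bigr => j _; congr (_ * _).
  by rewrite monoM mono_sign_even// mul1r mono_expR.
by rewrite monoM mono_expR; ring.
Qed.

Lemma meval_coord0 c (x : 'I_n -> R) i : x i = 0 ->
  meval x (circuit_poly alpha y b c) = \sum_j b 0 j * mono x (alpha j).
Proof.
move=> xi0; rewrite meval_circuit; set S := \sum_j _.
rewrite /mono (bigD1 i)//= xi0 expr0n eqn0Ngt (interior_exponent_gt0 indep lamP y_int i)/=.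
by rewrite mul0r mulr0 addr0.
Qed.

Definition nonneg_cond c := if even_mnm y then - Theta <= c else - Theta <= c <= Theta.

Lemma nonneg_circuitP c : nonneg_cond c <-> nonneg_poly (circuit_poly alpha y b c).
Proof.
split=> [hc x|nn].
  have [/existsP[i /eqP xi0]|/existsPn x0] := boolP [exists i, x 0 i == 0].
    rewrite (meval_coord0 _ xi0) sumr_ge0// => j _.
    by rewrite mulr_ge0 ?mono_even_ge0 ?(ltW (b_gt0 j)).
  have [s s1 xE] := real_polar x0.
  rewrite (meval_eq _ xE) meval_signed_exp// mulr_ge0 ?expR_ge0//.
  have [ws wsE] := equilibrium; have [gT _] := gsum_min (fun i => ln `|x 0 i|) wsE.
  move: hc; rewrite /nonneg_cond; case: ifPn => [ev|_].
    by rewrite mono_sign_even// mulr1; lra.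
  by move=> /andP[h1 h2]; case: (mono_sign y s1) => ->; lra.
have [ws wsE] := equilibrium.
have val (s : 'I_n -> R) : (forall i, s i = 1 \/ s i = -1) -> 0 <= Theta + c * mono s y.
  move=> s1; have := nn (\row_i (s i * expR (ws i))).
  rewrite (@meval_eq _ _ _ (fun i => s i * expR (ws i))); last by move=> i; rewrite mxE.
  by rewrite meval_signed_exp// pmulr_rge0 ?expR_gt0// gsum_equilibrium.
have h1 : - Theta <= c.
  have := val (fun=> 1) (fun=> or_introl erefl).
  by rewrite /mono big1 => [|i _]; [lra|rewrite expr1n].
rewrite /nonneg_cond; case: ifPn => // ev; rewrite h1/=.
by have [s s1 sE] := sign_vector_odd R ev; have := val s s1; rewrite sE; lra.
Qed.

Definition extremal_coef c := if even_mnm y then c = - Theta else `|c| = Theta.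

Lemma extremal_nonneg c : extremal_coef c -> nonneg_cond c.
Proof.
have T0 := circuit_number_gt0.
rewrite /extremal_coef /nonneg_cond; case: ifP => _ => [->//|cT].
by rewrite -ler_norml cT.
Qed.

(** If a coordinate of x vanishes, so does x^y, and f(x) is at least the constant
    term, which is positive. Otherwise f(x) = 0 forces gsum to attain its minimum at
    log |x|. *)
Lemma extremal_zero c (x : 'rV[R]_n) ws : (forall j,
    b 0 j * expR (dotm ws (alpha j) - dotm ws y) = lam j * Theta) ->
    extremal_coef c -> alpha ord0 = @mnm0 n ->
    real_zeros (circuit_poly alpha y b c) x ->
  forall i, `|x 0 i| = expR (ws i).
Proof.
move=> wsE ext a0; rewrite /real_zeros/= => fx0.
have x0 i : x 0 i != 0.
  apply/eqP => xi0; move/eqP: fx0; rewrite (meval_coord0 _ xi0) big_ord_recl a0.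
  rewrite /mono big1 => [|k _]; last by rewrite mnm0E expr0.
  rewrite gt_eqF// mulr1 ltr_pwDl// sumr_ge0// => j _.
  by rewrite mulr_ge0 ?mono_even_ge0 ?(ltW (b_gt0 _)).
have [s s1 xE] := real_polar x0.
move: fx0; rewrite (meval_eq _ xE) meval_signed_exp// => /eqP.
rewrite mulf_eq0 gt_eqF ?expR_gt0//= => /eqP h.
have [gT uniq] := gsum_min (fun i => ln `|x 0 i|) wsE.
have T0 := circuit_number_gt0.
have gE : gsum (fun i => ln `|x 0 i|) = Theta.
  move: ext; rewrite /extremal_coef; case: ifPn => [ev cT|_ cT].
    by move: h; rewrite mono_sign_even//; lra.
  have := ler_norm c; have := ler_norm (- c); rewrite normrN => h1 h2.
  by case: (mono_sign y s1) h => ->; lra.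
by move=> i; rewrite -(uniq gE i) lnK ?posrE ?normr_gt0.
Qed.

Lemma extremal_zeros_card c : extremal_coef c -> alpha ord0 = @mnm0 n ->
  (real_zeros (circuit_poly alpha y b c) #<= `I_(2 ^ n)%N)%card.
Proof.
move=> ext a0; have [ws wsE] := equilibrium.
set Z := real_zeros _; pose sgn (x : 'rV[R]_n) := [set i | 0 <= x 0 i]%SET.
have inj : {in Z &, injective sgn}.
  move=> x z /set_mem Zx /set_mem Zz sE; apply/rowP => i.
  have nx := extremal_zero wsE ext a0 Zx i; have nz := extremal_zero wsE ext a0 Zz i.
  have : (i \in sgn x) = (i \in sgn z) by rewrite sE.
  rewrite !inE; case: (ger0P (x 0 i)) nx => _ nx; case: (ger0P (z 0 i)) nz => _ nz // _; lra.
pose f x : nat := enum_rank (sgn x).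
have finj : {in Z &, injective f}.
  by move=> x z Zx Zz /val_inj/enum_rank_inj; exact: inj.
apply/card_subP; exists (f @` Z); first exact: inj_card_eq.
move=> _ [x _ <-] /=; have := ltn_ord (enum_rank (sgn x)).
rewrite [X in (_ < X)%N -> _](_ : _ = (2 ^ n)%N)//.
by rewrite -cardsT -powersetT card_powerset cardsT card_ord.
Qed.

Lemma meval_coef_continuous (x : 'I_n -> R) (q : 'rV[R]_n.+1 * R) :
  (fun p : 'rV[R]_n.+1 * R => meval x (circuit_poly alpha y p.1 p.2)) @ q
    --> meval x (circuit_poly alpha y q.1 q.2).
Proof.
under eq_cvg do rewrite meval_circuit.
rewrite meval_circuit; apply: cvgD.
  apply: cvg_sumr => j.
  by apply: cvgM; [exact: coef_continuous|exact: cvg_cst].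
by apply: cvgM; [exact: cvg_snd|exact: cvg_cst].
Qed.

(** f is the sum of even monomials with nonnegative coefficients and of k times a
    circuit polynomial with coefficients b and q.2 / k. *)
Lemma nonneg_scaled (q : 'rV[R]_n.+1 * R) k : 0 < k ->
  (forall j, k * b 0 j <= q.1 0 j) -> nonneg_cond (q.2 / k) ->
  nonneg_poly (circuit_poly alpha y q.1 q.2).
Proof.
move=> k0 kb /nonneg_circuitP nn x; have := nn x; rewrite !meval_circuit => h.
have -> : q.2 = k * (q.2 / k) by rewrite mulrC divfK ?gt_eqF.
rewrite -[q.1](addrNK (k *: b)).
under eq_bigr do rewrite mxE mulrDl.
rewrite big_split/= -addrA addr_ge0//.
  apply: sumr_ge0 => j _; rewrite mulr_ge0 ?mono_even_ge0// !mxE subr_ge0.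
  exact: kb.
under eq_bigr do rewrite mxE -mulrA.
by rewrite -mulr_sumr -mulrA -mulrDr mulr_ge0// ltW.
Qed.

(** A strict inequality for c still holds after shrinking b by some factor k < 1, and
    then [nonneg_scaled] covers all coefficients that stay above k b. *)
Lemma nonneg_interior c : nonneg_cond c -> ~ extremal_coef c ->
  \forall q \near ((b, c) : 'rV[R]_n.+1 * R), nonneg_poly (circuit_poly alpha y q.1 q.2).
Proof.
move=> nc next; have T0 := circuit_number_gt0.
(* the amount of the inner coefficient that Theta has to dominate *)
pose mu := if even_mnm y then Num.max 0 (- c) else `|c|.
have [mu0 muT] : 0 <= mu /\ mu < Theta.
  move: nc next; rewrite /mu /nonneg_cond /extremal_coef; case: ifP => _ h1 h2.
    rewrite le_max lexx gt_max T0 ltrNl lt_neqAle h1 andbT; split=> //.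
    by apply/eqP => h; apply: h2.
  by rewrite normr_ge0; split=> //; rewrite lt_neqAle ler_norml h1 andbT; apply/eqP.
(* any number strictly between mu / Theta and 1 would do *)
pose k := (1 + mu / Theta) / 2.
have muk : mu / Theta < 1 by rewrite ltr_pdivrMr// mul1r.
have muk0 : 0 <= mu / Theta by rewrite divr_ge0// ltW.
have [k0 k1] : 0 < k /\ k < 1 by rewrite /k; split; lra.
have mukT : mu < k * Theta by rewrite -ltr_pdivrMr// /k; lra.
have c1 : - (k * Theta) < c.
  move: mukT; rewrite /mu; case: ifP => _; first by rewrite gt_max => /andP[_]; lra.
  by rewrite ltr_norml => /andP[].
have c2 : ~~ even_mnm y -> c < k * Theta.
  by move=> /negbTE e; move: mukT; rewrite /mu e ltr_norml => /andP[].
have near_b : \forall q \near ((b, c) : 'rV[R]_n.+1 * R),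
    forall j, k * b 0 j < (q.1 : 'rV[R]_n.+1) 0 j.
  apply: (@filter_forall _ _ (fun j (q : 'rV[R]_n.+1 * R) => k * b 0 j < q.1 0 j)
    _ (nbhs_filter _)) => j.
  have : \forall z \near b 0 j, k * b 0 j < z by apply: lt_nbhsr; rewrite gtr_pMl.
  exact: (@coef_continuous R n (b, c) j).
have near_c : \forall q \near ((b, c) : 'rV[R]_n.+1 * R),
    - (k * Theta) < q.2 /\ (~~ even_mnm y -> q.2 < k * Theta).
  have n1 : \forall z \near c, - (k * Theta) < z by exact: lt_nbhsr.
  have n2 : \forall z \near c, ~~ even_mnm y -> z < k * Theta.
    have [e|e] := boolP (even_mnm y); first by near=> z.
    by apply: filterS (lt_nbhsl (c2 e)) => z + _.
  have sndc : (snd : 'rV[R]_n.+1 * R -> R) @ (b, c) --> c by exact: cvg_snd.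
  by apply: filterI; [exact: (sndc _ n1)|exact: (sndc _ n2)].
near=> q; apply: (nonneg_scaled k0).
  by move=> j; apply: ltW; move: j; near: q.
have [q1 q2] : - (k * Theta) < q.2 /\ (~~ even_mnm y -> q.2 < k * Theta) by near: q.
rewrite /nonneg_cond; case: ifPn => e; rewrite ler_pdivlMr//; first by lra.
by rewrite ler_pdivrMr//; have := q2 e; lra.
Unshelve. all: end_near. Qed.

Lemma boundary_circuitP c : c != 0 ->
  boundary_in (@circuit_coefs R n) (nonneg_coefs alpha y) (b, c) <-> extremal_coef c.
Proof.
move=> c0; have T0 := circuit_number_gt0.
have pA : circuit_coefs (b, c) by split.
have nbhsA B : nbhs ((b, c) : 'rV[R]_n.+1 * R) B ->
    nbhs ((b, c) : subspace (@circuit_coefs R n)) B.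
  by move=> nB; apply/(nbhs_subspace_ex _ pA); exists B.
split=> [[_ [clS clAS]]|ext].
  have nc : nonneg_cond c.
    apply/nonneg_circuitP => x; rewrite leNgt; apply/negP => fx.
    have nB : \forall q \near ((b, c) : 'rV[R]_n.+1 * R),
        meval (x 0) (circuit_poly alpha y q.1 q.2) < 0.
      exact: (@meval_coef_continuous (x 0) (b, c) _ (lt_nbhsl fx)).
    have [q [[_ /(_ x)]]] := clS _ (nbhsA _ nB).
    by rewrite leNgt => /negP h /= /h.
  apply: contrapT => next; have [q [[Aq Sq] nq]] := clAS _ (nbhsA _ (nonneg_interior nc next)).
  exact: Sq.
split=> //; split.
  apply: subset_closure; split=> //; apply/nonneg_circuitP.
  exact: extremal_nonneg.
move=> B /(nbhs_subspace_ex _ pA)[V nV BV].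
(* increasing |c| by a factor 1 + e destroys nonnegativity *)
pose f (e : R) : 'rV[R]_n.+1 * R := (b, (1 + e) * c).
have fc : f @ (0 : R) --> ((b, c) : 'rV[R]_n.+1 * R).
  have c1 : (fun e => (1 + e) * c) @ (0 : R) --> (1 + 0) * c.
    by apply: cvgM; [apply: cvgD; [exact: cvg_cst|exact: cvg_id]|exact: cvg_cst].
  rewrite addr0 mul1r in c1.
  exact: (cvg_pair (cvg_cst b) c1).
have [e [e0 Ve]] : exists e, 0 < e /\ V (f e).
  near (0 : R)^'+ => e; exists e; split; first by near: e; exact: nbhs_right_gt.
  by near: e; exact: (cvg_at_right_filter fc nV).
have fA : circuit_coefs (f e).
  by split=> //=; rewrite mulf_neq0// gt_eqF//; lra.
exists (f e); split; last first.
  have : (V `&` circuit_coefs (n:=n)) (f e) by [].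
  by rewrite -BV => -[].
split=> // -[_ /= /nonneg_circuitP].
have ec : 0 < e * `|c| by rewrite mulr_gt0// normr_gt0.
rewrite /nonneg_cond; move: ext; rewrite /extremal_coef; case: ifP => _ cT.
  by move: ec; rewrite cT normrN gtr0_norm//; lra.
rewrite -ler_norml normrM gtr0_norm; last by lra.
by rewrite mulrDl mul1r; lra.
Unshelve. all: end_near. Qed.

(** A sign change of the coordinates after which the inner term is negative on the
    positive orthant. *)
Definition align_sign c (s : 'I_n -> R) :=
  (forall i, s i = 1 \/ s i = -1) /\ c * mono s y = - `|c|.

Lemma align_sign_ex c : c < 0 \/ ~~ even_mnm y -> exists s, align_sign c s.
Proof.
move=> h; have [c0|c0] := ltP c 0.
  exists (fun=> 1); split; first by left.
  by rewrite /mono big1 ?mulr1 ?ltr0_norm ?opprK// => i _; rewrite expr1n.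
have [|s s1 sy] := sign_vector_odd R (m := y); first by case: h => //; rewrite ltNge c0.
by exists s; split=> //; rewrite sy ger0_norm// mulrN1.
Qed.

Definition sign_arg (s : 'I_n -> R) i : R := if s i == 1 then 0 else pi.

Lemma cis_sign_arg (s : 'I_n -> R) m : (forall i, s i = 1 \/ s i = -1) ->
  cis (dotm (sign_arg s) m) = real_complex R (mono s m).
Proof.
move=> s1; rewrite -mono_cis -mono_RtoC; apply: eq_bigr => i _; congr (_ ^+ _).
rewrite /sign_arg; case: (s1 i) => ->; first by rewrite eqxx cis0.
rewrite [_ == _](_ : _ = false); last by apply: lt_eqF; lra.
by apply/eqP; rewrite /cis cospi sinpi rmorphN1 eq_complex /= oppr0 !eqxx.
Qed.

(** Shifting the arguments by those of the signs turns the condition for a zero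
    into the closing condition of a linkage with arms b_j exp<w,alpha(j)> and bar
    |c| exp<w,y>. *)
Lemma fiber_aligned c s w th : align_sign c s ->
  fiber alpha y b c w (fun i => th i + sign_arg s i) =
  cis (dotm th y) *
  (\sum_j real_complex R (b 0 j * expR (dotm w (alpha j))) * cis (dotm th (alpha j) - dotm th y)
   - real_complex R (`|c| * expR (dotm w y))).
Proof.
move=> [s1 sc]; rewrite /fiber mulrBr mulr_sumr; congr (_ + _).
  apply: eq_bigr => j _; rewrite dotmD cisD cis_sign_arg// mono_sign_even// mulr1.
  by rewrite mulrCA -cisD addrC subrK.
rewrite dotmD cisD cis_sign_arg// mulrCA -rmorphM mulrAC sc.
by rewrite -mulrN -rmorphN -mulNr.
Qed.

Lemma gsum_continuous : continuous (fun w : 'rV[R]_n => gsum (w 0)).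
Proof.
have dc m (w : 'rV[R]_n) : (fun v : 'rV[R]_n => dotm (v 0) m) @ w --> dotm (w 0) m.
  apply: (cvg_sumr (F := nbhs w)) => i.
  apply: (cvgM (F := nbhs w)); [exact: coord_continuous|exact: cvg_cst].
suff h (w : 'rV[R]_n) : (fun v : 'rV[R]_n => gsum (v 0)) @ w --> gsum (w 0).
  by move=> w; exact: h.
apply: (cvg_sumr (F := nbhs w)) => j.
apply: (cvgM (F := nbhs w)); first exact: cvg_cst.
have uc : (fun v : 'rV[R]_n => dotm (v 0) (alpha j) - dotm (v 0) y) @ w -->
    dotm (w 0) (alpha j) - dotm (w 0) y by apply: (cvgB (F := nbhs w)); exact: dc.
exact: (cvg_comp _ _ uc (@continuous_expR R _)).
Qed.

Lemma gsum_amoeba c s (w : 'rV[R]_n) : align_sign c s -> gsum (w 0) = `|c| ->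
  amoeba (circuit_poly alpha y b c) w.
Proof.
move=> sc gw; apply/amoebaP; exists (fun i => 0 + sign_arg s i).
have d0 m : dotm (fun=> 0 : R) m = 0 by rewrite /dotm big1// => i _; rewrite mul0r.
rewrite fiber_aligned// d0 cis0 mul1r.
under eq_bigr do rewrite d0 subr0 cis0 mulr1.
by rewrite -rmorph_sum gsumE gw mulrC subrr.
Qed.

Lemma lopsided_complement c (w : 'rV[R]_n) : gsum (w 0) < `|c| ->
  ~ amoeba (circuit_poly alpha y b c) w.
Proof.
move=> gw /amoebaP[th /eqP]; rewrite /fiber addr_eq0 => /eqP/(congr1 Num.norm).
rewrite normrN normrM norm_cis mulr1 norm_RtoC normrM (gtr0_norm (expR_gt0 _)) => h.
have : real_complex R (`|c| * expR (dotm (w 0) y)) <=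
    real_complex R (\sum_j b 0 j * expR (dotm (w 0) (alpha j))).
  rewrite -h rmorph_sum; apply: le_trans (ler_norm_sum _ _ _) _; apply: ler_sum => j _.
  by rewrite normrM norm_cis mulr1 norm_RtoC gtr0_norm// mulr_gt0// expR_gt0.
by rewrite lecR gsumE mulrC ler_pM2l ?expR_gt0// leNgt gw.
Qed.

(** On a sublevel set each exponent <w, alpha(j) - y> is bounded above; since
    they average to 0 with positive weights they are also bounded below, and w
    depends linearly on them. *)
Lemma gsum_sublevel_bounded K : 0 < K ->
  exists M, forall w : 'I_n -> R, gsum w <= K -> forall i, `|w i| <= M i.
Proof.
move=> K0; pose B j := `|ln (K / b 0 j)|.
pose L j := B j + (\sum_k lam k * B k) / lam j.
exists (fun i => \sum_j `|invmx (vertex_mx R alpha) (lift 0 i) j| * L j) => w gw i.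
pose u j := dotm w (alpha j) - dotm w y.
have uB j : u j <= B j.
  apply: le_trans (ler_norm _); rewrite -ler_expR lnK ?posrE ?divr_gt0//.
  rewrite ler_pdivlMr// mulrC; apply: le_trans gw.
  rewrite /gsum (bigD1 j)//= lerDl sumr_ge0// => k _.
  by rewrite mulr_ge0 ?expR_ge0// ltW.
have u0 : \sum_j lam j * u j = 0.
  under eq_bigr do rewrite mulrBr.
  rewrite sumrB -(dotm_barycentric lamP) -mulr_suml.
  by case: lamP => _ -> _; rewrite mul1r subrr.
have B0 j : 0 <= B j by exact: normr_ge0.
have S0 : 0 <= \sum_k lam k * B k by apply: sumr_ge0 => k _; rewrite mulr_ge0// ltW// lam_gt0.
have uL j : `|u j| <= L j.
  have l0 := lam_gt0 j.
  have q0 : 0 <= (\sum_k lam k * B k) / lam j by rewrite divr_ge0// ltW.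
  rewrite ler_norml /L; apply/andP; split; last by have := uB j; lra.
  have : - (lam j * u j) <= \sum_k lam k * B k.
    move: u0; rewrite (bigD1 j)//= => /eqP; rewrite addr_eq0 => /eqP ->; rewrite opprK.
    rewrite [leRHS](bigD1 j)//= ler_wpDl ?mulr_ge0// ?(ltW l0)//.
    by apply: ler_sum => k _; rewrite ler_pM2l// lam_gt0.
  rewrite -mulrN mulrC -ler_pdivlMr// => h; have := B0 j; lra.
rewrite (affine_coords indep (k := - dotm w y) (phi := u)); last by move=> j; rewrite addrC.
apply: le_trans (ler_norm_sum _ _ _) _; apply: ler_sum => j _.
by rewrite normrM ler_wpM2l.
Qed.

(** On the component of the equilibrium point gsum is below |c|, because the level
    |c| lies in the amoeba and gsum takes connected sets to intervals. *)
Lemma not_nonneg_not_solid c s : align_sign c s -> Theta < `|c| ->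
  ~ solid (amoeba (circuit_poly alpha y b c)).
Proof.
move=> sc Tc sol; have [ws wsE] := equilibrium.
pose w0 : 'rV[R]_n := \row_i ws i.
have gw0 : gsum (w0 0) = Theta.
  rewrite -(gsum_equilibrium wsE); congr gsum; apply/funext => i; exact: mxE.
set A := amoeba _ in sol.
have w0A : (~` A) w0 by apply: lopsided_complement; rewrite gw0.
apply: (sol _ w0A); set C := connected_component _ _.
have C0 : C w0 by apply: connected_component_refl.
have CA : C `<=` ~` A by exact: connected_component_sub.
have Cc : connected C by exact: component_connected.
have gC w : C w -> gsum (w 0) <= `|c|.
  move=> Cw; rewrite leNgt; apply/negP => cg.
  have /connected_intervalP itv : connected ((fun w : 'rV[R]_n => gsum (w 0)) @` C).
    apply: connected_continuous_connected => //; apply: continuous_subspaceT.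
    exact: gsum_continuous.
  have [w1 Cw1 gw1] : ((fun w : 'rV[R]_n => gsum (w 0)) @` C) `|c|.
    apply: (itv (gsum (w0 0)) (gsum (w 0))); [by exists w0|by exists w|].
    by rewrite gw0 !ltW.
  exact: CA Cw1 (gsum_amoeba sc gw1).
have c0 : 0 < `|c| by apply: lt_trans Tc; exact: circuit_number_gt0.
have [M Mw] := gsum_sublevel_bounded c0.
exists (\sum_i `|M i|); split; first by rewrite realE sumr_ge0.
move=> K MK w /= Cw; apply: le_trans (ltW MK).
apply: row_norm_le => [|i]; first by rewrite sumr_ge0.
apply: le_trans (Mw _ (gC w Cw) i) _; apply: le_trans (ler_norm _) _.
by rewrite (bigD1 i)//= lerDl sumr_ge0.
Qed.

(** Here j0 is the arm that dominates at th0, and the ray follows the integral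
    direction that raises the vertex j0 above all the others. Were there a zero
    over w + s v with argument th1, then exp(s) would be a root of the polynomial at
    the end of the path from th0 to th1. *)
Lemma ray_complement c (w : 'rV[R]_n) j0 (th0 : 'I_n -> R) d : (0 < n)%N ->
    ~ amoeba (circuit_poly alpha y b c) w ->
    `|\sum_(k | k != j0) real_complex R (b 0 k * expR (dotm (w 0) (alpha k))) *
        cis (dotm th0 (alpha k))| = real_complex R d ->
    `|c| * expR (dotm (w 0) y) + d < b 0 j0 * expR (dotm (w 0) (alpha j0)) ->
  exists2 v : 'rV[R]_n, v != 0 & forall s, 0 <= s ->
    ~ amoeba (circuit_poly alpha y b c) (w + s *: v).
Proof.
move=> n0 wA Td dom.
have [N [k0 [m [N0 mE]]]] := integral_cocharacter indep j0.
pose v : 'rV[R]_n := \row_i (m i)%:~R.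
have dotv p : dotm (v 0) p = (dotm m p)%:~R.
  by rewrite /dotm rmorph_sum; apply: eq_bigr => i _; rewrite mxE rmorphM rmorph_nat.
pose kR : R := k0%:~R.
have vE j : dotm (v 0) (alpha j) = (if j == j0 then N%:R else 0) - kR.
  have := congr1 (fun z : int => z%:~R : R) (mE j).
  rewrite rmorphD /= -dotv -/kR => h.
  have -> : dotm (v 0) (alpha j) = (if j == j0 then N%:Z else 0)%:~R - kR.
    by rewrite -h addrC addKr.
  by case: ifP.
have vy : dotm (v 0) y = N%:R * lam j0 - kR.
  rewrite (dotm_barycentric lamP) (bigD1 j0)//= vE eqxx.
  under eq_bigr => j jj0 do rewrite vE (negbTE jj0) sub0r mulrN.
  have l1 : \sum_j lam j = 1 by case: lamP.
  rewrite (bigD1 j0)//= in l1.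
  rewrite sumrN -mulr_suml.
  have -> : \sum_(i < n.+1 | i != j0) lam i = 1 - lam j0 by lra.
  ring.
(* N lam j0 is an integer, as y and the direction are integral, and less than N *)
have [e [eN eE]] : exists e : nat, (e < N)%N /\ dotm (v 0) y = e%:R - kR.
  have zE : (k0 + dotm m y)%:~R = N%:R * lam j0.
    by rewrite rmorphD /= -dotv vy /kR; ring.
  have : 0 <= k0 + dotm m y.
    by rewrite -(ler0z R) zE mulr_ge0// ltW// lam_gt0.
  case E : (k0 + dotm m y) => [e|//] _; exists e; move: zE; rewrite E => zE.
  split; last by rewrite vy -zE.
  rewrite -(ltr_nat R) -[e%:R]/((Posz e)%:~R) zE gtr_pMr ?ltr0n//.
  exact: (barycentric_lt1 indep lamP y_int).
exists v.
  apply/eqP => v0; have := vE j0; rewrite eqxx.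
  have [k kj] : exists k, k != j0.
    have [->|] := eqVneq j0 ord0; last by exists ord0; rewrite eq_sym.
    by exists ord_max; rewrite -val_eqE/= -lt0n.
  have := vE k; rewrite (negbTE kj) v0.
  have d0 p : dotm ((0 : 'rV[R]_n) 0) p = 0 by rewrite /dotm big1// => i _; rewrite mxE mul0r.
  rewrite !d0 => /eqP; rewrite sub0r eq_sym oppr_eq0 => /eqP -> /eqP.
  by rewrite subr0 eq_sym pnatr_eq0 eqn0Ngt N0.
move=> s s0 /amoebaP[th1 fth1].
pose r j := b 0 j * expR (dotm (w 0) (alpha j)).
pose g := c * expR (dotm (w 0) y).
pose th t i := th0 i + t * (th1 i - th0 i).
pose B t j := real_complex R (r j) * cis (dotm (th t) (alpha j)).
pose Cc t := real_complex R g * cis (dotm (th t) y).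
pose T t := \sum_(k | k != j0) B t k.
pose P t : {poly R[i]} := B t j0 *: 'X^N + (Cc t *: 'X^e + (T t)%:P).
have r0 j : 0 < r j by rewrite mulr_gt0// expR_gt0.
have nB t j : `|B t j| = real_complex R (r j).
  by rewrite normrM norm_cis mulr1 norm_RtoC gtr0_norm.
have B0 t j : B t j != 0 by rewrite -normr_gt0 nB ltcR.
have size_low t : (size (Cc t *: 'X^e + (T t)%:P)%R <= N)%N.
  rewrite (leq_trans (size_polyD _ _))// geq_max; apply/andP; split.
    by rewrite (leq_trans (size_scale_leq _ _))// size_polyXn.
  by rewrite (leq_trans (size_polyC_leq1 _)).
have size_top t : size (B t j0 *: 'X^N) = N.+1 by rewrite size_scale// size_polyXn.
have sP t : size (P t) = N.+1 by rewrite /P size_polyDl size_top// ltnS.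
have lP t : `|lead_coef (P t)| = real_complex R (r j0).
  by rewrite /P lead_coefDl ?size_top ?ltnS// lead_coefZ lead_coefXn mulr1 nB.
have PE t u : (P t).[u] = B t j0 * u ^+ N + (Cc t * u ^+ e + T t) by rewrite /P !hornerE.
have dth t p : dotm (th t) p = dotm th0 p + t * (dotm th1 p - dotm th0 p).
  by rewrite /th dotmD dotmZ dotmB.
have cisc p : continuous (fun t => cis (dotm (th t) p) : (R[i] : numFieldType)).
  have uc (t : R) : (fun t : R => dotm th0 p + t * (dotm th1 p - dotm th0 p)) @ t -->
      dotm th0 p + t * (dotm th1 p - dotm th0 p).
    apply: cvgD; first exact: cvg_cst.
    by apply: cvgM; [exact: cvg_id|exact: cvg_cst].
  under eq_fun do rewrite dth.
  by move=> t; exact: (cvg_comp _ _ (uc t) (@cis_continuous R _)).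
have mulc (a : R[i]) (f : R -> (R[i] : numFieldType)) : continuous f ->
    continuous (fun t => a * f t : (R[i] : numFieldType)).
  by move=> fc t; apply: cvgM; [exact: cvg_cst|exact: fc].
have Bc j : continuous (fun t => B t j : (R[i] : numFieldType)) by apply: mulc; exact: cisc.
have Ccc : continuous (Cc : R -> (R[i] : numFieldType)) by apply: mulc; exact: cisc.
have coefc i : continuous (fun t => (P t)`_i : (R[i] : numFieldType)).
  under eq_fun do rewrite /P !coefD !coefZ !coefXn coefC.
  move=> t; apply: cvgD; first by apply: cvgM; [exact: Bc|exact: cvg_cst].
  apply: cvgD; first by apply: cvgM; [exact: Ccc|exact: cvg_cst].
  case: (i == 0)%N; last exact: cvg_cst.
  by rewrite /T; apply: cvg_big => [|k _]; [exact: add_continuous|exact: Bc].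
(* over w + s v, at the argument th t + psi v, the value of f is a nonzero factor a
   times the value of P t at u = exp(s + i psi) *)
have fiberP t u (a : R[i]) (w' th' : 'I_n -> R) :
    (forall j, real_complex R (b 0 j * expR (dotm w' (alpha j))) * cis (dotm th' (alpha j)) =
       a * (B t j * (if j == j0 then u ^+ N else 1))) ->
    real_complex R (c * expR (dotm w' y)) * cis (dotm th' y) = a * (Cc t * u ^+ e) ->
    fiber alpha y b c w' th' = a * (P t).[u].
  move=> hB hC; rewrite PE /fiber hC (bigD1 j0)//= hB eqxx.
  rewrite (eq_bigr (fun k => a * B t k)); last first.
    by move=> k kj; rewrite hB (negbTE kj) mulr1.
  rewrite -mulr_sumr -/(T t); ring.
have circle t u : `|u| = 1 -> ~~ root (P t) u.
  move=> u1; apply/negP => /rootP Pu; apply: wA; apply/amoebaP.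
  have [psi uE] := polar u.
  have {}uE : u = cis psi.
    have nu : ComplexField.Normc.normc u = 1.
      by apply: (@complexI R); rewrite -norm_complexE u1.
    by rewrite uE nu mul1r.
  exists (fun i => th t i + psi * v 0 i).
  have psiN q : cis (psi * (q - kR)) = cis (- (psi * kR)) * cis (psi * q).
    by rewrite -cisD; congr cis; ring.
  rewrite (fiberP t u (cis (- (psi * kR)))) ?Pu ?mulr0//.
    move=> j; rewrite dotmD dotmZ vE cisD psiN /B -/(r j).
    by case: ifP => _; rewrite ?uE ?cisXn ?mulr0 ?cis0; ring.
  by rewrite dotmD dotmZ eE cisD psiN -/g /Cc uE cisXn; ring.
have start u : 1 <= `|u| -> ~~ root (P 0) u.
  move=> u1; apply/negP => /rootP; rewrite PE => /eqP; rewrite addr_eq0 => /eqP/(congr1 Num.norm).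
  rewrite normrM nB normrX normrN => h.
  have uN0 : 0 < `|u| ^+ N by rewrite exprn_gt0//; apply: lt_le_trans u1.
  have : `|Cc 0 * u ^+ e + T 0| <= real_complex R (`|g| + d) * `|u| ^+ N.
    apply: le_trans (ler_normD _ _) _; rewrite rmorphD mulrDl lerD//.
      rewrite normrM normrX normrM norm_cis mulr1 norm_RtoC ler_wpM2l ?lecR//.
      by apply: ler_weXn2l => //; exact: ltnW.
    have -> : `|T 0| = real_complex R d.
      rewrite -Td /T; congr `|_|; apply: eq_bigr => k _.
      by rewrite /B dth mul0r addr0.
    rewrite ler_peMr ?exprn_ege1//.
    by rewrite -Td.
  rewrite -h ler_pM2r// lecR leNgt => /negP; apply.
  by rewrite /g normrM (gtr0_norm (expR_gt0 _)).
have nocross : forall t u, 1 <= `|u| -> ~~ root (P t) u.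
  exact: no_root_crossing sP lP coefc circle start.
have := nocross 1 (real_complex R (expR s)).
have es1 : 1 <= expR s by rewrite -expR0 ler_expR.
rewrite norm_RtoC (gtr0_norm (expR_gt0 _)) -[1]/(real_complex R 1) lecR => /(_ es1)/negP; apply.
apply/rootP.
have th1E p : dotm (th 1) p = dotm th1 p by rewrite dth mul1r addrC subrK.
have expE q : expR (s * (q - kR)) = expR (- (s * kR)) * expR (s * q).
  by rewrite -expRD; congr expR; ring.
have expN q : real_complex R (expR (s * q%:R)) = real_complex R (expR s) ^+ q.
  by rewrite -rmorphXn -expRM_natl mulrC.
have wsE p : dotm ((w + s *: v) 0) p = dotm (w 0) p + s * dotm (v 0) p.
  by rewrite -dotmZ -dotmD; apply: eq_bigr => i _; rewrite !mxE.
have := fth1; rewrite (fiberP 1 (real_complex R (expR s)) (real_complex R (expR (- (s * kR))))).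
- have E0 : real_complex R (expR (- (s * kR))) != 0 by rewrite eq_complex /= gt_eqF ?expR_gt0.
  by move/eqP; rewrite mulf_eq0 (negbTE E0) orFb => /eqP.
- move=> j; rewrite wsE vE expRD expE /B /r th1E.
  by case: ifP => _; rewrite -?expN ?mulr0 ?expR0 ?mulr1 !rmorphM; ring.
- by rewrite wsE eE expRD expE /Cc /g th1E -expN !rmorphM; ring.
Qed.

Lemma nonneg_solid c s : (1 < n)%N -> align_sign c s -> `|c| <= Theta ->
  solid (amoeba (circuit_poly alpha y b c)).
Proof.
move=> n1 sc cT w wA.
pose r j := b 0 j * expR (dotm (w 0) (alpha j)).
pose g := `|c| * expR (dotm (w 0) y).
have r0 j : 0 < r j by rewrite mulr_gt0// expR_gt0.
have gS : g <= \sum_j r j.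
  have [ws wsE] := equilibrium; have [gT _] := gsum_min (w 0) wsE.
  by rewrite gsumE /g mulrC ler_pM2l ?expR_gt0// (le_trans cT).
have cardI : (2 < #|'I_n.+1|)%N by rewrite card_ord.
have l0 j : 0 < lam j by exact: lam_gt0.
case: (arms_dichotomy cardI r0 l0 gS) => [[phi [hl hc hs]]|[j0 [psi [d [d0 gd hc hs]]]]].
  exfalso; apply: wA; apply/amoebaP.
  have setTE (F : 'I_n.+1 -> R) : \sum_(i in [set: 'I_n.+1]%SET) F i = \sum_i F i.
    by apply: eq_bigl => i; rewrite inE.
  rewrite !setTE in hl hc hs.
  have [th thE] := circuit_interp indep lamP hl.
  exists (fun i => th i + sign_arg s i); rewrite fiber_aligned//.
  under eq_bigr do rewrite thE.
  rewrite sum_cis hc hs [X in _ * X](_ : _ = 0) ?mulr0//.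
  by apply/eqP; rewrite eq_complex /= oppr0 addr0 subrr !eqxx.
have [k [th thE]] := affine_interp indep psi.
have setDE (F : 'I_n.+1 -> R) : \sum_(i in [set: 'I_n.+1]%SET :\ j0) F i = \sum_(i | i != j0) F i.
  by apply: eq_bigl => i; rewrite !inE andbT.
rewrite !setDE in hc hs.
have Td : `|\sum_(i | i != j0) real_complex R (r i) * cis (dotm th (alpha i))| = real_complex R d.
  have -> : \sum_(i | i != j0) real_complex R (r i) * cis (dotm th (alpha i)) =
      cis (- k) * \sum_(i | i != j0) real_complex R (r i) * cis (psi i).
    rewrite mulr_sumr; apply: eq_bigr => i _; rewrite mulrCA -cisD -thE.
    by rewrite addKr.
  by rewrite sum_cis hc hs normrM norm_cis mul1r (norm_RtoC d) ger0_norm.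
have [v v0 ray] := ray_complement (ltnW n1) wA Td gd.
exact: ray_unbounded v0 ray.
Qed.

End Circuit.

Theorem theorem1p1 (R : realType) (n : nat)
    (alpha : 'I_n.+1 -> multinom n) (y : multinom n)
    (b : 'rV[R]_n.+1) (c : R) (lam : 'I_n.+1 -> R)
    (alpha_indep : affinely_independent (fun j => mnm_point R (alpha j)))
    (alpha_even : forall j, even_mnm (alpha j))
    (y_int : interior (conv_hull (fun j => mnm_point R (alpha j)))
               (mnm_point R y))
    (b_gt0 : forall j, 0 < b 0 j) (c_neq0 : c != 0)
    (lamP : convex_coords (fun j => mnm_point R (alpha j))
              (mnm_point R y) lam) :
  let f := circuit_poly alpha y b c in
  let Theta := circuit_number lam b in
  let extremal := if even_mnm y then c = - Theta else `|c| = Theta in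
  [/\ (* (A) *)
      (if even_mnm y then - Theta <= c else - Theta <= c <= Theta)
        <-> nonneg_poly f,
      (* (B) *)
      (boundary_in (@circuit_coefs R n) (nonneg_coefs alpha y) (b, c)
         <-> extremal)
      /\ (extremal -> alpha ord0 = @mnm0 n ->
           (real_zeros f #<= `I_(2 ^ n)%N)%card /\
           (forall x x', real_zeros f x -> real_zeros f x' ->
              forall i, `|x 0 i| = `|x' 0 i|))
    & (* (C) *)
      (2 <= n)%N -> ~ (sum_of_monomial_squares f /\ 0 < c) ->
        (nonneg_poly f <->
           (if even_mnm y then - Theta <= c <= 0
            else - Theta <= c <= Theta))
        /\ (nonneg_poly f <-> solid (amoeba f))].
Proof.
move=> f Theta extremal.
have nnP : nonneg_cond y b lam c <-> nonneg_poly f.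
  exact: (nonneg_circuitP alpha_indep alpha_even y_int b_gt0 lamP).
have extE : extremal = extremal_coef y b lam c by [].
split; first exact: nnP.
  split; first exact: (boundary_circuitP alpha_indep alpha_even y_int b_gt0 lamP).
  move=> ext a0; split.
    exact: (extremal_zeros_card alpha_indep alpha_even y_int b_gt0 lamP ext a0).
  have [ws wsE] := equilibrium alpha_indep y_int b_gt0 lamP.
  move=> x x' fx fx' i.
  rewrite (extremal_zero alpha_indep alpha_even y_int b_gt0 lamP wsE ext a0 fx).
  by rewrite (extremal_zero alpha_indep alpha_even y_int b_gt0 lamP wsE ext a0 fx').
move=> n2 notsq.
have c_or : c < 0 \/ ~~ even_mnm y.
  have [ev|] := boolP (even_mnm y); last by right.
  left; rewrite lt_neqAle c_neq0 leNgt; apply/negP => c0; apply: notsq; split=> //.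
  exact: circuit_squares.
have T0 : 0 < Theta := circuit_number_gt0 alpha_indep y_int b_gt0 lamP.
have condE : nonneg_cond y b lam c <-> `|c| <= Theta.
  rewrite /nonneg_cond ler_norml; case: ifP c_or => [ev [c0|//]|_ _ //].
  by split=> [->|/andP[]//]; rewrite /= (le_trans (ltW c0))// ltW.
split.
  rewrite -nnP /nonneg_cond; case: ifP c_or => [ev [c0|//]|_ _ //].
  by rewrite (ltW c0) andbT.
have [s sc] := align_sign_ex c_or.
rewrite -nnP condE; split=> [cT|sol].
  exact: (nonneg_solid alpha_indep alpha_even y_int b_gt0 lamP n2 sc cT).
rewrite leNgt; apply/negP => cT.
exact: (not_nonneg_not_solid alpha_indep alpha_even y_int b_gt0 lamP sc cT sol).
Qed.
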